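(* Let $N\geq 3$ and let $u=u(x,t)$ be the solution of the Cauchy problem \[ \partial_t^2u+\tfrac{1}{4}L^2u+\tfrac{\pi^2}{4}u+L\,\partial_tu=0\ \ (x\in\mathbb{R}^N,\ t>0),\qquad u(x,0)=u_0(x),\quad \partial_tu(x,0)=u_1(x), \] where $L=\log(-\Delta+I)$, with initial data $u_0\in D(L)\cap L^1(\mathbb{R}^N)$ and $u_1\in L^2(\mathbb{R}^N)\cap L^1(\mathbb{R}^N)$. Then there exist constants $C>0$ and $t_0>0$ depending only on $N$ such that, for all $t\geq t_0$, \[ \begin{split} &\|\partial_t u(\cdot,t)\|^2_{L^2(\mathbb{R}^N)}+\frac{1}{4}\|Lu(\cdot,t)\|^2_{L^2(\mathbb{R}^N)}+\frac{\pi^2}{4}\| u(\cdot,t)\|_{L^2(\mathbb{R}^N)}^2\\ &\leq C\left(\| u_1\|^{2}_{L^1(\mathbb{R}^N)} t^{-\frac{N}{2}} +\| u_0\|^{2}_{L^1(\mathbb{R}^N)} t^{-\frac{N+4}{2}} + \pi^2\| u_0\|^{2}_{L^1(\mathbb{R}^N)} t^{-\frac{N}{2}} \right)\\ &\quad + C\left( 2^{-\frac{2}{3}t} \| u_1\|^{2}_{L^2(\mathbb{R}^N)} +\frac{16 + 9\pi^2}{36}\, 2^{-\frac{2}{3}t}\| u_0\|_{L^2(\mathbb{R}^N)}^2 \right) + C e^{-\frac{8}{9}t} E_u (0), \end{split} \] where $E_u(0)=\frac12\left(\|u_1\|_{L^2(\mathbb{R}^N)}^2+\frac14\|Lu_0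\|_{L^2(\mathbb{R}^N)}^2+\frac{\pi^2}{4}\|u_0\|_{L^2(\mathbb{R}^N)}^2\right)$.
   Context: Fourier transform: $\hat f(\xi)=\mathcal F(f)(\xi)=\int_{\mathbb{R}^N}e^{-ix\cdot\xi}f(x)\,dx$ for $f\in L^1(\mathbb{R}^N)$, extended to $L^2(\mathbb{R}^N)$ as usual. The operator $L=\log(-\Delta+I):D(L)\subset L^2(\mathbb{R}^N)\to L^2(\mathbb{R}^N)$ has domain $D(L)=\{f\in L^2(\mathbb{R}^N):\int_{\mathbb{R}^N}\log^2(1+|\xi|^2)|\hat f(\xi)|^2d\xi<\infty\}$ and is defined by $\widehat{Lf}(\xi)=\log(1+|\xi|^2)\hat f(\xi)$. For $u_0\in D(L)$, $u_1\in L^2(\mathbb{R}^N)$, the solution of the Cauchy problem is the unique mild solution $u\in C([0,\infty);D(L))\cap C^1([0,\infty);L^2(\mathbb{R}^N))$; equivalently, its spatial Fourier transform $\hat u(\xi,t)$ solves, for a.e. $\xi\in\mathbb{R}^N$, the ODE $\partial_t^2\hat u+\frac14\log^2(1+|\xi|^2)\hat u+\frac{\pi^2}{4}\hat u+\log(1+|\xi|^2)\partial_t\hat u=0$ for $t>0$, with $\hat u(\xi,0)=\hat u_0(\xi)$, $\partial_t\hat u(\xi,0)=\hat u_1(\xi)$. *)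

(* Defs.v *)
From HB Require Import structures.
From mathcomp Require Export all_boot all_order all_algebra.
From mathcomp Require Export complex.
From mathcomp Require Export all_classical all_reals all_analysis.

Set Implicit Arguments.
Unset Strict Implicit.
Unset Printing Implicit Defensive.

Import Order.TTheory GRing.Theory Num.Theory.
Export numFieldNormedType.Exports.

Local Open Scope classical_set_scope.
Local Open Scope ring_scope.
Local Open Scope complex_scope.

Notation Rn R n := (n.-tuple (measurableTypeR R)).
Notation normc := ComplexField.Normc.normc.

Section lebesgue_Rn.
Context {R : realType}.

Definition cons_Rn n (p : Rn R n * measurableTypeR R) : Rn R n.+1 :=
  [tuple of p.2 :: p.1].

Lemma measurable_cons_Rn n : measurable_fun setT (@cons_Rn n).
Proof. by apply: measurable_cons; [exact: measurable_snd|exact: measurable_fst]. Qed.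

Definition leb_succ n (mu : {measure set (Rn R n) -> \bar R}) :
    {measure set (Rn R n.+1) -> \bar R} :=
  measure_function_pushforward__canonical__measure_function_Measure
    (mu \x lebesgue_measure)%E (@measurable_cons_Rn n).

(* Lebesgue measure on R^n: R^(n+1) carries the image of the product of the
   measures of R^n and R (the library has no n-fold product of sigma-finite
   measures). *)
Fixpoint leb n : {measure set (Rn R n) -> \bar R} :=
  match n with
  | 0 => \d_([tuple] : Rn R 0)
  | m.+1 => leb_succ (leb m)
  end.

(* Together with sigma-finiteness, this determines leb n. *)
Lemma leb_box n (A : 'I_n -> set (measurableTypeR R)) :
  (forall i, measurable (A i)) ->
  leb n [set x | forall i, A i (tnth x i)] =
  (\prod_(i < n) lebesgue_measure (A i))%E.
Proof.
elim: n A => [|n IH] A mA.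
  by rewrite big_ord0 /= diracE mem_set// => -[].
rewrite big_ord_recl.
transitivity ((leb n \x lebesgue_measure)%E
    (@cons_Rn n @^-1` [set x | forall i, A i (tnth x i)])) => //.
have -> : @cons_Rn n @^-1` [set x | forall i, A i (tnth x i)] =
    [set x | forall i, A (lift ord0 i) (tnth x i)] `*` A ord0.
  apply/seteqP; split => [[x y] /= H|[x y] /= [Hx Hy] i].
    by split => [i|]; [have := H (lift ord0 i); rewrite tnthS|exact: (H ord0)].
  by case: (unliftP ord0 i) => [j ->|->]; [rewrite tnthS|].
rewrite product_measure1E//.
  by rewrite muleC; congr (_ * _)%E; exact: (IH (fun i => A (lift ord0 i))).
rewrite (_ : [set _ | _] =
  \bigcap_(i in [set: 'I_n]) ((fun x => tnth x i) @^-1` A (lift ord0 i))).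
  apply: fin_bigcap_measurable => // i _.
  by rewrite -[_ @^-1` _]setTI; exact: measurable_tnth.
by apply/seteqP; split => [x H i _|x H i]; exact: H.
Qed.

End lebesgue_Rn.

Section Lebesgue_spaces.
Context {R : realType} {n : nat}.
Implicit Types (p : \bar R) (f : Rn R n -> R[i]).

Definition cmeasurable f : Prop :=
  measurable_fun setT (fun x => complex.Re (f x) : R) /\
  measurable_fun setT (fun x => complex.Im (f x) : R).

(* The possibly infinite norm; [normL] below is only meant for f in L^p. *)
Definition enormL p f : \bar R :=
  Lnorm (leb n) p (fun x => (normc (f x))%:E).

Definition normL p f : R := fine (enormL p f).

Definition inL p f : Prop := cmeasurable f /\ (enormL p f < +oo)%E.

End Lebesgue_spaces.

Section Fourier.
Context {R : realType} {n : nat}.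
Implicit Types (x xi : Rn R n) (f g : Rn R n -> R[i]).

Definition dotp x xi : R := \sum_(i < n) tnth x i * tnth xi i.

Definition cintegral f : R[i] :=
  (\int[leb n]_x complex.Re (f x)) +i* (\int[leb n]_x complex.Im (f x)).

(* f x is multiplied by exp(- i x.xi) = cos (x.xi) - i sin (x.xi). *)
Definition fourier1 f xi : R[i] :=
  cintegral (fun x => (cos (dotp x xi) -i* sin (dotp x xi)) * f x).

(* g represents the Fourier transform of f in L^2, i.e. the value at f of the
   continuous extension of [fourier1] from L^1 `&` L^2. *)
Definition is_fourier f g : Prop :=
  [/\ inL 2%:E f, inL 2%:E g &
      exists fk : nat -> Rn R n -> R[i],
        [/\ forall k, inL 1%:E (fk k) /\ inL 2%:E (fk k),
            enormL 2%:E (fun x => fk k x - f x) @[k --> \oo] --> 0%E &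
            enormL 2%:E (fun xi => fourier1 (fk k) xi - g xi)
              @[k --> \oo] --> 0%E]].

Definition logsym xi : R := ln (1 + dotp xi xi).

Definition domL f : Prop :=
  inL 2%:E f /\
  exists g, is_fourier f g /\
    (\int[leb n]_xi (logsym xi ^+ 2 * normc (g xi) ^+ 2)%:E < +oo)%E.

(* h represents Lf. *)
Definition is_opL f h : Prop :=
  exists2 g, is_fourier f g &
    is_fourier h (fun xi => (logsym xi)%:C * g xi).

(* A representative of Lf; it exists, and is unique almost everywhere, for f in
   D(L). *)
Definition opL f : Rn R n -> R[i] := xget (fun=> 0) [set h | is_opL f h].

Definition graph_enorm f : \bar R := (enormL 2%:E f + enormL 2%:E (opL f))%E.

End Fourier.

Section Cauchy_problem.
Context {R : realType} {n : nat}.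

(* l is the derivative at t of phi restricted to [0, +oo[; it is one-sided for
   t = 0. *)
Definition is_cderive (phi : R -> R[i]) (t : R) (l : R[i]) : Prop :=
  normc ((phi s - phi t) / (s - t)%:C - l)
    @[s --> within [set s | 0 <= s] t^'] --> (0 : R).

Definition is_ccontinuous (phi : R -> R[i]) (t : R) : Prop :=
  normc (phi s - phi t) @[s --> within [set s | 0 <= s] (nbhs t)] --> (0 : R).

(* v is the time derivative of u in L^2. *)
Definition C1_L2 (u v : R -> Rn R n -> R[i]) : Prop :=
  forall t, 0 <= t ->
    [/\ inL 2%:E (u t), inL 2%:E (v t),
        enormL 2%:E (fun x => (u s x - u t x) / (s - t)%:C - v t x)
          @[s --> within [set s | 0 <= s] t^'] --> 0%E &
        enormL 2%:E (fun x => v s x - v t x)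
          @[s --> within [set s | 0 <= s] (nbhs t)] --> 0%E].

Definition C0_domL (u : R -> Rn R n -> R[i]) : Prop :=
  forall t, 0 <= t ->
    domL (u t) /\
    graph_enorm (fun x => u s x - u t x)
      @[s --> within [set s | 0 <= s] (nbhs t)] --> 0%E.

(* U t is a representative of the Fourier transform of u t, and V its pointwise
   time derivative: such representatives can be chosen so that, for almost
   every xi, U ^~ xi solves the ordinary differential equation. *)
Definition fourier_ode (u0 u1 : Rn R n -> R[i]) (u : R -> Rn R n -> R[i]) :
    Prop :=
  exists U V : R -> Rn R n -> R[i],
    [/\ forall t, 0 <= t -> is_fourier (u t) (U t),
        is_fourier u0 (U 0),
        is_fourier u1 (V 0) &
        {ae leb n, forall xi,
          [/\ forall t, 0 <= t -> is_cderive (U ^~ xi) t (V t xi),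
              forall t, 0 <= t -> is_ccontinuous (V ^~ xi) t &
              forall t, 0 < t -> exists2 W : R[i],
                is_cderive (V ^~ xi) t W &
                W + (4^-1 * logsym xi ^+ 2)%:C * U t xi
                  + (pi ^+ 2 / 4)%:C * U t xi
                  + (logsym xi)%:C * V t xi = 0]}].

(* u is the solution with data u0, u1, and ut is its time derivative. *)
Definition is_solution (u0 u1 : Rn R n -> R[i]) (u ut : R -> Rn R n -> R[i]) :
    Prop :=
  [/\ C0_domL u, C1_L2 u ut,
      {ae leb n, forall x, u 0 x = u0 x},
      {ae leb n, forall x, ut 0 x = u1 x} &
      fourier_ode u0 u1 u].

Definition energy0 (u0 u1 : Rn R n -> R[i]) : R :=
  2^-1 * (normL 2%:E u1 ^+ 2 + 4^-1 * normL 2%:E (opL u0) ^+ 2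
          + pi ^+ 2 / 4 * normL 2%:E u0 ^+ 2).

End Cauchy_problem.

(* Main.v *)
Require Import Defs.
From HB Require Import structures.
From mathcomp Require Import all_boot all_order all_algebra complex.
From mathcomp Require Import all_classical all_reals all_analysis.
From mathcomp Require Import measurable_realfun.
From mathcomp Require Import ring lra.

Set Implicit Arguments.
Unset Strict Implicit.
Unset Printing Implicit Defensive.

Import Order.TTheory GRing.Theory Num.Theory.
Import numFieldNormedType.Exports.

Local Open Scope classical_set_scope.
Local Open Scope ring_scope.

(* Put a = log (1 + |xi|^2).  For each frequency, exp (a t) (|V + a U / 2|^2 +
   pi^2 |U|^2 / 4) is constant along the differential equation, so |U|^2,
   a^2 |U|^2 and |V|^2 are at most 8 (1 + a^2)^2 exp (- a t) times
   |U 0|^2 + |V 0|^2.  For t >= 1 this weight is dominated by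
   exp (- t |xi|^2 / 8) + exp (- 8 t / 9), as is seen by separating
   |xi|^2 <= 7 from |xi|^2 > 7.  Against the Gaussian, bounding the transforms of
   the data by their L^1 norms gives t^(- N / 2); against the exponential, their
   L^2 norms give exp (- 8 t / 9) E_u(0).  The remaining terms of the bound are
   nonnegative.
   The norms of a function and of its transform need only be compared up to a
   constant.  On the line this comes from the identity
     c * int (int_(x - r)^(x + r) a)^2 dx
       = int (1 - cos (2 r xi)) / xi^2 * |transform of a|^2 dxi
   with c = int (1 - cos s) / s^2 ds, as r tends to 0, and it passes to R^n by
   transforming one variable at a time. *)

(** Multiplying a transform by exp (a t / 2) turns its equation into a harmonic oscillator of
    frequency pi / 2, whatever a is; the conserved quantity is the energy of that oscillator. Going
    back to U, a U and V costs powers of a only. These are bounded at low frequencies, and at high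
    ones a third of the exponent absorbs them, since t >= 1: there a >= 4 / 3, and 8 / 9 is 2 / 3 of
    4 / 3. Three obstacles shape the rest. Transforms in L^2 are limits along unspecified sequences,
    so the norm comparison is used in both directions, from the data to their transforms and from
    transforms back to the solution; it also yields uniqueness almost everywhere, which identifies U
    0 and V 0 with integral transforms. The function V is tied to a transform at time 0 only, so the
    velocity is reached through increments of U. Lastly, an integrable function may fail to be
    square integrable, and its slices are integrable only almost everywhere; hence the comparison is
    stated in the extended reals, and partial transforms are prescribed on good slices only. *)

Section ae_integral.
Context d (T : measurableType d) (R : realType).
Variable mu : {measure set T -> \bar R}.
Local Open Scope ereal_scope.

(** The maximum of f and g equals g almost everywhere and dominates f at every point, which reduces
    the claim to the pointwise comparison. *)
Lemma ge0_ae_le_integral (f g : T -> \bar R) :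
  measurable_fun setT f -> measurable_fun setT g ->
  (forall x, 0 <= f x) -> (forall x, 0 <= g x) ->
  {ae mu, forall x, f x <= g x} -> \int[mu]_x f x <= \int[mu]_x g x.
Proof.
move=> mf mg f0 g0 fg.
have mm : measurable_fun setT (fun x => maxe (f x) (g x)).
  exact: measurable_maxe.
rewrite (@ge0_ae_eq_integral _ _ _ mu _ g (fun x => maxe (f x) (g x)))//.
- apply: ge0_le_integral => // x _.
  by rewrite le_max lexx.
- by move=> x _; rewrite le_max f0.
- by apply: filterS fg => x fgx _; apply/esym/max_idPr.
Qed.

Lemma ae_eq_Rintegral (f g : T -> R) :
  measurable_fun setT f -> measurable_fun setT g ->
  {ae mu, forall x, f x = g x} -> (\int[mu]_x f x = \int[mu]_x g x)%R.
Proof.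
move=> mf mg fg; rewrite /Rintegral; congr fine; apply: ae_eq_integral => //.
- exact/measurable_EFinP.
- exact/measurable_EFinP.
- by apply: filterS fg => x -> _.
Qed.

Lemma integrable_EFin_Rintegral (f : T -> R) :
  mu.-integrable setT (EFin \o f) ->
  (\int[mu]_x f x)%:E = \int[mu]_x (f x)%:E.
Proof. by move=> fi; rewrite /Rintegral fineK//; exact: integrable_fin_num. Qed.

Lemma integrable_bounded_mulr (f h : T -> R) (M : R) :
  measurable_fun setT h -> (forall x, `|h x| <= M)%R ->
  mu.-integrable setT (EFin \o f) ->
  mu.-integrable setT (EFin \o (fun x => h x * f x)%R).
Proof.
move=> mh hM fi.
have mf : measurable_fun setT f by apply/measurable_EFinP; exact: measurable_int fi.
apply: (le_integrable measurableT (g := EFin \o (fun x => M * f x)%R)).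
- by apply/measurable_EFinP; exact: measurable_funM.
- move=> x _ /=; rewrite lee_fin !normrM ler_wpM2r//.
  by rewrite (le_trans (hM x))// ler_norm.
- by apply: (eq_integrable measurableT) (integrableZl measurableT M fi) => x _.
Qed.

End ae_integral.

(** * Fubini's theorem for real-valued integrals *)

Section Rintegral_param.
Context d1 d2 (X : measurableType d1) (Y : measurableType d2) (R : realType).
Variable nu : {sigma_finite_measure set Y -> \bar R}.

(** Tonelli applies to the positive and negative parts separately, so the slices of h may be
    non-integrable; [fine] then fixes a value. *)
Lemma measurable_Rintegral_param (h : X * Y -> R) :
  measurable_fun setT h ->
  measurable_fun setT (fun x => \int[nu]_y h (x, y)).
Proof.
move=> mh; rewrite /Rintegral.
apply: (@measurableT_comp _ _ _ _ _ _ fine) => //.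
pose f := EFin \o h; rewrite [X in measurable_fun _ X](_ : _ =
    (fun x => \int[nu]_y f^\+ (x, y) - \int[nu]_y f^\- (x, y))%E); last first.
  apply/funext => x; rewrite -[LHS]/(\int[nu]_y f (x, y))%E [LHS]integralE.
  under eq_integral do rewrite funepos_comp.
  by under [X in (_ - X = _)%E]eq_integral do rewrite funeneg_comp.
apply: emeasurable_funB.
- apply: (measurable_fun_fubini_tonelli_F f^\+)%E => //.
  exact/measurable_funepos/measurable_EFinP.
- apply: (measurable_fun_fubini_tonelli_F f^\-)%E => //.
  exact/measurable_funeneg/measurable_EFinP.
Qed.

Variable mu : {sigma_finite_measure set X -> \bar R}.

Lemma integrable_Rintegral1 (h : X * Y -> R) :
  (mu \x nu)%E.-integrable setT (EFin \o h) ->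
  mu.-integrable setT (EFin \o (fun x => \int[nu]_y h (x, y))).
Proof.
move=> hi; have mh : measurable_fun setT h.
  by apply/measurable_EFinP; exact: measurable_int hi.
apply: le_integrable (integrable_fubini_F hi) => //.
- by apply/measurable_EFinP; exact: measurable_Rintegral_param.
- move=> x _; rewrite /fubini_F /Rintegral/=.
  (* On a slice with infinite integral [fine] returns 0, which is still dominated. *)
  by case: (\int[nu]_y _)%E => //=; rewrite ?lee_fin ?normr0 ?leey.
Qed.

Lemma Rintegral_prod1 (h : X * Y -> R) :
  (mu \x nu)%E.-integrable setT (EFin \o h) ->
  \int[mu]_x \int[nu]_y h (x, y) = \int[(mu \x nu)%E]_z h z.
Proof.
move=> hi; have mh : measurable_fun setT h.
  by apply/measurable_EFinP; exact: measurable_int hi.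
rewrite /Rintegral -(integral12_prod_meas1 hi); congr fine.
apply: ae_eq_integral => //.
- by apply/measurable_EFinP; exact: measurable_Rintegral_param.
- exact: (measurable_fubini_F hi).
(* [fine] alters the inner integral only on non-integrable slices, which form a null set. *)
- apply: filterS (ae_integrable1 hi) => x hx _.
  exact: integrable_EFin_Rintegral.
Qed.

End Rintegral_param.

Section Rintegral_prod2.
Context d1 d2 (X : measurableType d1) (Y : measurableType d2) (R : realType).
Variable mu : {sigma_finite_measure set X -> \bar R}.
Variable nu : {sigma_finite_measure set Y -> \bar R}.

Lemma measurable_Rintegral_param2 (h : X * Y -> R) :
  measurable_fun setT h ->
  measurable_fun setT (fun y => \int[mu]_x h (x, y)).
Proof.
move=> mh; apply: (@measurable_Rintegral_param _ _ _ _ _ mu (h \o unstable.swap)).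
by apply: measurableT_comp => //; exact: measurable_swap.
Qed.

Lemma integrable_swap (h : X * Y -> \bar R) :
  (mu \x nu)%E.-integrable setT h ->
  (nu \x mu)%E.-integrable setT (h \o unstable.swap).
Proof.
move=> hi; have mh := measurable_int _ hi.
apply/integrable12ltyP.
  by apply: measurableT_comp => //; exact: measurable_swap.
by move/(integrable21ltyP mu nu mh): hi.
Qed.

Lemma integrable_Rintegral2 (h : X * Y -> R) :
  (mu \x nu)%E.-integrable setT (EFin \o h) ->
  nu.-integrable setT (EFin \o (fun y => \int[mu]_x h (x, y))).
Proof. by move=> /integrable_swap /integrable_Rintegral1. Qed.

Lemma Rintegral_prod2 (h : X * Y -> R) :
  (mu \x nu)%E.-integrable setT (EFin \o h) ->
  \int[nu]_y \int[mu]_x h (x, y) = \int[(mu \x nu)%E]_z h z.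
Proof.
move=> hi; have mh : measurable_fun setT h.
  by apply/measurable_EFinP; exact: measurable_int hi.
rewrite /Rintegral -(integral21_prod_meas1 hi); congr fine.
apply: ae_eq_integral => //.
- by apply/measurable_EFinP; exact: measurable_Rintegral_param2.
- exact: (measurable_fubini_G hi).
- apply: filterS (ae_integrable2 hi) => y hy _.
  exact: integrable_EFin_Rintegral.
Qed.

End Rintegral_prod2.

Section measurable_trig.
Context {R : realType}.

Lemma measurable_cos : measurable_fun setT (@cos R).
Proof. by apply: continuous_measurable_fun; exact: continuous_cos. Qed.

Lemma measurable_sin : measurable_fun setT (@sin R).
Proof. by apply: continuous_measurable_fun; exact: continuous_sin. Qed.

End measurable_trig.

(** * Plancherel inequalities on a product *)

Section transform.
Context d (X : measurableType d) (R : realType).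
Variables (mu : {measure set X -> \bar R}) (phi : X -> X -> R).
Implicit Types a b : X -> R.

(* The real part of the transform of a + i b with kernel exp (- i phi); its
   imaginary part is the real part of the transform of b - i a. *)
Definition fourier_re a b xi : R :=
  \int[mu]_x (cos (phi x xi) * a x + sin (phi x xi) * b x).

Definition sqnorm a b : \bar R := (\int[mu]_x (a x ^+ 2 + b x ^+ 2)%:E)%E.

(** The functions tested are integrable but perhaps not square integrable, so both sides may be
    infinite. The constant stands in for the exact power of 2 pi. *)
Definition plancherel : Prop :=
  exists2 K : R, 0 < K & forall a b,
    mu.-integrable setT (EFin \o a) -> mu.-integrable setT (EFin \o b) ->
    (sqnorm (fourier_re a b) (fourier_re b (\- a)%R) <= K%:E * sqnorm a b)%E /\
    (sqnorm a b <= K%:E * sqnorm (fourier_re a b) (fourier_re b (\- a)%R))%E.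

End transform.

Section transform_theory.
Context d (X : measurableType d) (R : realType).
Variables (mu : {measure set X -> \bar R}) (phi : X -> X -> R).
Hypothesis mphi : measurable_fun setT (fun z : X * X => phi z.1 z.2).
Implicit Types a b : X -> R.

Lemma integrable_measurable a :
  mu.-integrable setT (EFin \o a) -> measurable_fun setT a.
Proof. by move=> ai; apply/measurable_EFinP; exact: measurable_int ai. Qed.

Lemma integrable_opp a :
  mu.-integrable setT (EFin \o a) -> mu.-integrable setT (EFin \o (\- a)).
Proof. by move=> ai; apply: (eq_integrable measurableT) (integrableN ai) => x _. Qed.

Lemma integrable_add a b :
  mu.-integrable setT (EFin \o a) -> mu.-integrable setT (EFin \o b) ->
  mu.-integrable setT (EFin \o (fun x => a x + b x)).
Proof.
by move=> ai bi; apply: (eq_integrable measurableT) (integrableD measurableT ai bi) => x _.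
Qed.

Lemma fourier_re_opp a b xi :
  mu.-integrable setT (EFin \o (fun x => cos (phi x xi) * a x + sin (phi x xi) * b x)) ->
  fourier_re mu phi (\- a) (\- b) xi = - fourier_re mu phi a b xi.
Proof.
move=> abi; rewrite /fourier_re -mulN1r -RintegralZl//.
by apply: eq_Rintegral => x _ /=; ring.
Qed.

Lemma integrable_fourier_re a b xi :
  mu.-integrable setT (EFin \o a) -> mu.-integrable setT (EFin \o b) ->
  mu.-integrable setT
    (EFin \o (fun x => cos (phi x xi) * a x + sin (phi x xi) * b x)).
Proof.
move=> ai bi.
have mx : measurable_fun setT (fun x => phi x xi).
  exact: (measurableT_comp mphi (pair2_measurable xi)).
apply: integrable_add.
- apply: (integrable_bounded_mulr (M := 1)) => // [|x].
    exact: (measurableT_comp measurable_cos mx).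
  exact: cos_max.
- apply: (integrable_bounded_mulr (M := 1)) => // [|x].
    exact: (measurableT_comp measurable_sin mx).
  exact: sin_max.
Qed.

Lemma measurable_sqsum a b :
  measurable_fun setT a -> measurable_fun setT b ->
  measurable_fun setT (fun x => (a x ^+ 2 + b x ^+ 2)%:E).
Proof.
by move=> ma mb; apply/measurable_EFinP; apply: measurable_funD;
  apply: measurable_funX.
Qed.

Lemma sqsum_ge0 a b x : (0 <= (a x ^+ 2 + b x ^+ 2)%:E)%E.
Proof. by rewrite lee_fin addr_ge0// sqr_ge0. Qed.

End transform_theory.
#[local] Hint Resolve sqsum_ge0 : core.

Section transform_measurable.
Context d (X : measurableType d) (R : realType).
Variables (mu : {sigma_finite_measure set X -> \bar R}) (phi : X -> X -> R).
Hypothesis mphi : measurable_fun setT (fun z : X * X => phi z.1 z.2).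

Lemma measurable_fourier_re (a b : X -> R) :
  measurable_fun setT a -> measurable_fun setT b ->
  measurable_fun setT (fourier_re mu phi a b).
Proof.
move=> ma mb.
apply: (@measurable_Rintegral_param2 _ _ _ _ _ mu
  (fun z => cos (phi z.1 z.2) * a z.1 + sin (phi z.1 z.2) * b z.1)).
have mc := measurableT_comp measurable_cos mphi.
have ms := measurableT_comp measurable_sin mphi.
by apply: measurable_funD; apply: measurable_funM => //; exact: measurableT_comp.
Qed.

End transform_measurable.

Section transform_product.
Context d1 d2 (X : measurableType d1) (Y : measurableType d2) (R : realType).
Variables (mu : {sigma_finite_measure set X -> \bar R}).
Variables (nu : {sigma_finite_measure set Y -> \bar R}).
Variables (phi : X -> X -> R) (psi : Y -> Y -> R).
Hypothesis mphi : measurable_fun setT (fun z : X * X => phi z.1 z.2).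
Hypothesis mpsi : measurable_fun setT (fun z : Y * Y => psi z.1 z.2).
Implicit Types a b : X * Y -> R.

Definition prod_phase (z w : X * Y) : R := phi z.1 w.1 + psi z.2 w.2.

Lemma measurable_prod_phase :
  measurable_fun setT (fun z : (X * Y) * (X * Y) => prod_phase z.1 z.2).
Proof.
apply: measurable_funD.
- apply: (measurableT_comp mphi (g := fun z : (X * Y) * (X * Y) => (z.1.1, z.2.1))).
  by apply: measurable_fun_pair; apply: measurableT_comp.
- apply: (measurableT_comp mpsi (g := fun z : (X * Y) * (X * Y) => (z.1.2, z.2.2))).
  by apply: measurable_fun_pair; apply: measurableT_comp.
Qed.

(** The kernel exp (- i (phi + psi)) factors, so the transform in y comes first and the one in x
    follows; in real form this is the pair of addition formulas. P and Q are constrained only where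
    both slices are integrable: linearity in y, needed to recognise Q as the opposite of a
    transform, holds only there. *)
Lemma fourier_re_prod a b (P Q : X -> R) xi eta :
  (mu \x nu)%E.-integrable setT (EFin \o a) ->
  (mu \x nu)%E.-integrable setT (EFin \o b) ->
  measurable_fun setT P -> measurable_fun setT Q ->
  (forall x, let ax y := a (x, y) in let bx y := b (x, y) in
    nu.-integrable setT (EFin \o ax) -> nu.-integrable setT (EFin \o bx) ->
    P x = fourier_re nu psi ax bx eta /\
    Q x = fourier_re nu psi bx (\- ax) eta) ->
  fourier_re (mu \x nu)%E prod_phase a b (xi, eta) = fourier_re mu phi P Q xi.
Proof.
move=> ai bi mP mQ PQ.
have abi := integrable_fourier_re measurable_prod_phase (xi, eta) ai bi.
have mx : measurable_fun setT (fun x => phi x xi).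
  exact: (measurableT_comp mphi (pair2_measurable xi)).
rewrite /fourier_re -(Rintegral_prod1 abi); apply: ae_eq_Rintegral.
- exact: measurable_Rintegral_param (integrable_measurable abi).
- apply: measurable_funD; apply: measurable_funM => //.
    exact: (measurableT_comp measurable_cos mx).
  exact: (measurableT_comp measurable_sin mx).
- apply: filterS2 (ae_integrable1 ai) (ae_integrable1 bi) => x axi bxi.
  have [-> ->] := PQ x axi bxi; rewrite /fourier_re.
  have i1 := integrable_fourier_re mpsi eta axi bxi.
  have i2 := integrable_fourier_re mpsi eta bxi (integrable_opp axi).
  have i3 : nu.-integrable setT (EFin \o (fun y => cos (phi x xi) *
      (cos (psi y eta) * a (x, y) + sin (psi y eta) * b (x, y)))).
    exact: (integrable_bounded_mulr (M := 1)) (fun=> cos_max _) i1.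
  have i4 : nu.-integrable setT (EFin \o (fun y => sin (phi x xi) *
      (cos (psi y eta) * b (x, y) + sin (psi y eta) * - a (x, y)))).
    exact: (integrable_bounded_mulr (M := 1)) (fun=> sin_max _) i2.
  rewrite -!RintegralZl// -RintegralD//; apply: eq_Rintegral => y _ /=.
  by rewrite /prod_phase/= cosD sinD; ring.
Qed.

End transform_product.

Section plancherel_product.
Context d1 d2 (X : measurableType d1) (Y : measurableType d2) (R : realType).
Variables (mu : {sigma_finite_measure set X -> \bar R}).
Variables (nu : {sigma_finite_measure set Y -> \bar R}).
Variables (phi : X -> X -> R) (psi : Y -> Y -> R).
Hypothesis mphi : measurable_fun setT (fun z : X * X => phi z.1 z.2).
Hypothesis mpsi : measurable_fun setT (fun z : Y * Y => psi z.1 z.2).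
Implicit Types a b : X * Y -> R.

Let ptl a b (z : X * Y) : R :=
  fourier_re nu psi (fun y => a (z.1, y)) (fun y => b (z.1, y)) z.2.

Let measurable_ptl a b :
  measurable_fun setT a -> measurable_fun setT b -> measurable_fun setT (ptl a b).
Proof.
move=> ma mb; apply: (measurable_Rintegral_param nu
  (h := fun w : (X * Y) * Y => cos (psi w.2 w.1.2) * a (w.1.1, w.2)
                               + sin (psi w.2 w.1.2) * b (w.1.1, w.2))).
have m1 : measurable_fun setT (fun w : (X * Y) * Y => (w.2, w.1.2)).
  by apply: measurable_fun_pair => //; exact: measurableT_comp.
have m2 : measurable_fun setT (fun w : (X * Y) * Y => (w.1.1, w.2)).
  by apply: measurable_fun_pair => //; exact: measurableT_comp.
have mps := measurableT_comp mpsi m1.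
apply: measurable_funD; apply: measurable_funM.
- exact: (measurableT_comp measurable_cos mps).
- exact: (measurableT_comp ma m2).
- exact: (measurableT_comp measurable_sin mps).
- exact: (measurableT_comp mb m2).
Qed.

Let integrable_ptl a b eta :
  (mu \x nu)%E.-integrable setT (EFin \o a) ->
  (mu \x nu)%E.-integrable setT (EFin \o b) ->
  mu.-integrable setT (EFin \o (fun x => ptl a b (x, eta))).
Proof.
move=> ai bi; apply: (integrable_Rintegral1 (nu := nu) (mu := mu)
  (h := fun z => cos (psi z.2 eta) * a z + sin (psi z.2 eta) * b z)).
have mp : measurable_fun setT (fun z : X * Y => psi z.2 eta).
  apply: (measurableT_comp mpsi (g := fun z : X * Y => (z.2, eta))).
  by apply: measurable_fun_pair.
apply: integrable_add.
- apply: (integrable_bounded_mulr (M := 1)) => // [|x]; last exact: cos_max.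
  exact: (measurableT_comp measurable_cos mp).
- apply: (integrable_bounded_mulr (M := 1)) => // [|x]; last exact: sin_max.
  exact: (measurableT_comp measurable_sin mp).
Qed.

Let measurable_joint a b :
  measurable_fun setT a -> measurable_fun setT b ->
  measurable_fun setT (fun w : X * Y =>
    fourier_re mu phi (fun x => a (x, w.2)) (fun x => b (x, w.2)) w.1).
Proof.
move=> ma mb; apply: (measurable_Rintegral_param2 mu
  (h := fun w : X * (X * Y) => cos (phi w.1 w.2.1) * a (w.1, w.2.2)
                               + sin (phi w.1 w.2.1) * b (w.1, w.2.2))).
have m1 : measurable_fun setT (fun w : X * (X * Y) => (w.1, w.2.1)).
  by apply: measurable_fun_pair => //; exact: measurableT_comp.
have m2 : measurable_fun setT (fun w : X * (X * Y) => (w.1, w.2.2)).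
  by apply: measurable_fun_pair => //; exact: measurableT_comp.
have mps := measurableT_comp mphi m1.
apply: measurable_funD; apply: measurable_funM.
- exact: (measurableT_comp measurable_cos mps).
- exact: (measurableT_comp ma m2).
- exact: (measurableT_comp measurable_sin mps).
- exact: (measurableT_comp mb m2).
Qed.

Let sqnorm_prod1 a b : measurable_fun setT a -> measurable_fun setT b ->
  sqnorm (mu \x nu)%E a b =
  (\int[mu]_x sqnorm nu (fun y => a (x, y)) (fun y => b (x, y)))%E.
Proof. by move=> ma mb; rewrite /sqnorm fubini_tonelli1//; exact: measurable_sqsum. Qed.

Let sqnorm_prod2 a b : measurable_fun setT a -> measurable_fun setT b ->
  sqnorm (mu \x nu)%E a b =
  (\int[nu]_y sqnorm mu (fun x => a (x, y)) (fun x => b (x, y)))%E.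
Proof. by move=> ma mb; rewrite /sqnorm fubini_tonelli2//; exact: measurable_sqsum. Qed.

Let measurable_sqnorm1 a b : measurable_fun setT a -> measurable_fun setT b ->
  measurable_fun setT (fun x => sqnorm nu (fun y => a (x, y)) (fun y => b (x, y))).
Proof.
move=> ma mb.
exact: (measurable_fun_fubini_tonelli_F _ (measurable_sqsum ma mb)).
Qed.

Let measurable_sqnorm2 a b : measurable_fun setT a -> measurable_fun setT b ->
  measurable_fun setT (fun y => sqnorm mu (fun x => a (x, y)) (fun x => b (x, y))).
Proof.
move=> ma mb.
exact: (measurable_fun_fubini_tonelli_G _ (measurable_sqsum ma mb)).
Qed.

(** The squared norm of the partial transform (p, q) lies between the two sides: it is compared with
    that of (a, b) by integrating the inequality in y over x, and with that of the full transform by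
    integrating the inequality in x over eta. Each passage costs one constant. *)
Lemma plancherel_prod : plancherel mu phi -> plancherel nu psi ->
  plancherel (mu \x nu)%E (prod_phase phi psi).
Proof.
move=> [K1 K10 HX] [K2 K20 HY]; exists (K1 * K2); first exact: mulr_gt0.
move=> a b ai bi.
have [ma mb] := (integrable_measurable ai, integrable_measurable bi).
have nai := integrable_opp ai; have mna := integrable_measurable nai.
pose p := ptl a b; pose q := ptl b (\- a).
have [mp mq] : measurable_fun setT p /\ measurable_fun setT q.
  by split; apply: measurable_ptl.
pose F1 := fourier_re (mu \x nu)%E (prod_phase phi psi) a b.
pose F2 := fourier_re (mu \x nu)%E (prod_phase phi psi) b (\- a).
have pi1 eta := integrable_ptl eta ai bi.
have qi eta := integrable_ptl eta bi nai.
have F1E eta : (fun xi => F1 (xi, eta)) =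
    fourier_re mu phi (fun x => p (x, eta)) (fun x => q (x, eta)).
  apply/funext => xi; apply: fourier_re_prod => //.
  - exact: (measurableT_comp mp (pair2_measurable eta)).
  - exact: (measurableT_comp mq (pair2_measurable eta)).
(* Since b - i a is - i (a + i b), its partial transform is given by the pair (q, - p). *)
have F2E eta : (fun xi => F2 (xi, eta)) =
    fourier_re mu phi (fun x => q (x, eta)) (\- (fun x => p (x, eta))).
  apply/funext => xi; apply: fourier_re_prod => //.
  - exact: (measurableT_comp mq (pair2_measurable eta)).
  - by apply: measurableT_comp => //; exact: (measurableT_comp mp (pair2_measurable eta)).
  - move=> x ax bx bxi axi; split => //.
    rewrite /bx fourier_re_opp//.
    apply: integrable_fourier_re => //.
    have := integrable_opp axi; congr (_.-integrable _ _).
    by apply/funext => y /=; rewrite opprK.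
have mF1 : measurable_fun setT F1.
  rewrite (_ : F1 = fun w => fourier_re mu phi (fun x => p (x, w.2)) (fun x => q (x, w.2)) w.1).
    exact: measurable_joint.
  by apply/funext => -[xi eta] /=; rewrite -F1E.
have mF2 : measurable_fun setT F2.
  rewrite (_ : F2 = fun w => fourier_re mu phi (fun x => q (x, w.2)) (fun x => - p (x, w.2)) w.1).
    have mnp : measurable_fun setT (fun z => - p z) by exact: measurableT_comp.
    exact: (measurable_joint mq mnp).
  by apply/funext => -[xi eta] /=; rewrite -F2E.
have EE : sqnorm (mu \x nu)%E F1 F2 = (\int[nu]_eta sqnorm mu
    (fourier_re mu phi (fun x => p (x, eta)) (fun x => q (x, eta)))
    (fourier_re mu phi (fun x => q (x, eta)) (\- (fun x => p (x, eta)))%R))%E.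
  rewrite (sqnorm_prod2 mF1 mF2); apply: eq_integral => eta _.
  exact: (congr2 (sqnorm mu) (F1E eta) (F2E eta)).
have mE : measurable_fun setT (fun eta => sqnorm mu
    (fourier_re mu phi (fun x => p (x, eta)) (fun x => q (x, eta)))
    (fourier_re mu phi (fun x => q (x, eta)) (\- (fun x => p (x, eta)))%R)).
  rewrite (_ : (fun _ => _) =
      fun eta => sqnorm mu (fun xi => F1 (xi, eta)) (fun xi => F2 (xi, eta))).
    exact: (measurable_sqnorm2 mF1 mF2).
  by apply/funext => eta; exact/esym/(congr2 (sqnorm mu) (F1E eta) (F2E eta)).
have sq0 d (T : measurableType d) (m : {measure set T -> \bar R}) (u v : T -> R) :
    (0 <= sqnorm m u v)%E by apply: integral_ge0.
have GE := sqnorm_prod2 mp mq; have GE' := sqnorm_prod1 mp mq.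
have HE := sqnorm_prod1 ma mb.
(* In y the inequality is available for almost every x only, whereas p and q are integrable in x for
   every eta. *)
have good := filterS2 _ (fun x axi bxi => HY _ _ axi bxi) (ae_integrable1 ai) (ae_integrable1 bi).
split.
- rewrite [sqnorm _ (fourier_re _ _ a b) _]EE EFinM -muleA.
  apply: (@le_trans _ _ (K1%:E * sqnorm (mu \x nu)%E p q)%E).
    rewrite GE -ge0_integralZl_EFin//; [|exact: measurable_sqnorm2|exact: ltW].
    apply: ge0_le_integral => //.
      by apply: measurable_funeM; exact: measurable_sqnorm2.
    by move=> eta _; exact: (HX _ _ (pi1 eta) (qi eta)).1.
  rewrite lee_pmul2l// GE' HE -ge0_integralZl_EFin//; [|exact: measurable_sqnorm1|exact: ltW].
  apply: ge0_ae_le_integral => //.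
  + exact: measurable_sqnorm1.
  + by apply: measurable_funeM; exact: measurable_sqnorm1.
  + by move=> x; rewrite mule_ge0// lee_fin ltW.
  + by apply: filterS (good _) => x [].
- rewrite [sqnorm _ (fourier_re _ _ a b) _]EE (mulrC K1) EFinM -muleA.
  apply: (@le_trans _ _ (K2%:E * sqnorm (mu \x nu)%E p q)%E).
    rewrite GE' HE -ge0_integralZl_EFin//; [|exact: measurable_sqnorm1|exact: ltW].
    apply: ge0_ae_le_integral => //.
    + exact: measurable_sqnorm1.
    + by apply: measurable_funeM; exact: measurable_sqnorm1.
    + by move=> x; rewrite mule_ge0// lee_fin ltW.
    + by apply: filterS (good _) => x [].
  rewrite lee_pmul2l// GE -ge0_integralZl_EFin//; last exact: ltW.
  apply: ge0_le_integral => //.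
  + exact: measurable_sqnorm2.
  + exact: measurable_funeM.
  + by move=> eta _; exact: (HX _ _ (pi1 eta) (qi eta)).2.
Qed.

End plancherel_product.

(** * The Gram identity for a superposition of functions *)

Section gram.
Context d1 d2 (T : measurableType d1) (Y : measurableType d2) (R : realType).
Variables (rho : {sigma_finite_measure set T -> \bar R}).
Variables (nu : {sigma_finite_measure set Y -> \bar R}).
Variables (e : T * Y -> R) (a : Y -> R) (M : R).
Hypothesis me : measurable_fun setT e.
Hypothesis M0 : 0 <= M.
Hypothesis eM : forall z, `|e z| <= M.
Hypothesis e2M : forall y, (\int[rho]_t (e (t, y) ^+ 2)%:E <= M%:E)%E.
Hypothesis ai : nu.-integrable setT (EFin \o a).

Let ma : measurable_fun setT a. Proof. exact: integrable_measurable ai. Qed.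
Let met y : measurable_fun setT (fun t => e (t, y)).
Proof. exact: (measurableT_comp me (pair2_measurable y)). Qed.
Let mey t : measurable_fun setT (fun y => e (t, y)).
Proof. exact: (measurableT_comp me (pair1_measurable t)). Qed.

Let B t : R := \int[nu]_y (e (t, y) * a y).
Let G y z : R := \int[rho]_t (e (t, y) * e (t, z)).

(** The product is at most the half-sum of the two squares, each of integral at most M. *)
Lemma gram_cross_le y z : (\int[rho]_t `|e (t, y) * e (t, z)|%:E <= M%:E)%E.
Proof.
have h0 : 0 <= 2^-1 :> R by rewrite invr_ge0.
have mm (s : Y) : measurable_fun setT (fun t => (e (t, s) ^+ 2)%:E).
  by apply/measurable_EFinP; exact: measurable_funX.
have m0 (s : Y) t : (0 <= (e (t, s) ^+ 2)%:E)%E by rewrite lee_fin sqr_ge0.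
apply: (@le_trans _ _ (\int[rho]_t
    (2^-1%:E * (e (t, y) ^+ 2)%:E + 2^-1%:E * (e (t, z) ^+ 2)%:E))%E).
  apply: ge0_le_integral => //.
  - by apply/measurable_EFinP; apply: measurableT_comp => //; exact: measurable_funM.
  - by apply: emeasurable_funD; apply: measurable_funeM.
  - move=> t _; rewrite -!EFinM -EFinD lee_fin normrM.
    have := sqr_ge0 (`|e (t, y)| - `|e (t, z)|).
    rewrite sqrrB !real_normK ?num_real//; lra.
rewrite ge0_integralD//; last 4 first.
- by move=> t _; rewrite mule_ge0// lee_fin.
- by apply: measurable_funeM.
- by move=> t _; rewrite mule_ge0// lee_fin.
- by apply: measurable_funeM.
rewrite !ge0_integralZl_EFin//.
apply: (@le_trans _ _ (2^-1%:E * M%:E + 2^-1%:E * M%:E)%E).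
  by apply: leeD; apply: lee_pmul => //; exact: integral_ge0.
by rewrite -!EFinM -EFinD lee_fin; lra.
Qed.

Lemma integrable_gram_cross y z :
  rho.-integrable setT (EFin \o (fun t => e (t, y) * e (t, z))).
Proof.
apply/integrableP; split.
  by apply/measurable_EFinP; exact: measurable_funM.
exact: le_lt_trans (gram_cross_le y z) (ltry _).
Qed.

Let A1 : R := \int[nu]_y `|a y|.

Let A1E : (\int[nu]_y `|a y|%:E = A1%:E)%E.
Proof. by rewrite -integrable_EFin_Rintegral//; exact: integrable_norm. Qed.

Let mh2 y : measurable_fun setT (fun w : T * Y => e (w.1, y) * (e w * a w.2)).
Proof.
apply: measurable_funM.
  by apply: (measurableT_comp me (g := fun w : T * Y => (w.1, y))); exact: measurable_fun_pair.
by apply: measurable_funM => //; exact: measurableT_comp.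
Qed.

Let tonelli2 y :
  (\int[rho]_t \int[nu]_z `|e (t, y) * (e (t, z) * a z)|%:E <= (M * A1)%:E)%E.
Proof.
rewrite (fubini_tonelli (fun w => `|e (w.1, y) * (e w * a w.2)|%:E))//; last first.
  by apply/measurable_EFinP; apply: measurableT_comp => //; exact: mh2.
have mna : measurable_fun setT (fun z => `|a z|%:E).
  by apply/measurable_EFinP; exact: measurableT_comp.
rewrite EFinM -A1E -ge0_integralZl_EFin//.
apply: ge0_le_integral => //.
- by move=> z _; exact: integral_ge0.
- apply: (measurable_fun_fubini_tonelli_G (fun w => `|e (w.1, y) * (e w * a w.2)|%:E)) => //.
  by apply/measurable_EFinP; apply: measurableT_comp => //; exact: mh2.
- exact: measurable_funeM.
- move=> z _ /=.
  under eq_integral do rewrite mulrCA mulrA mulrC normrM EFinM.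
  rewrite ge0_integralZl_EFin//; last first.
    by apply/measurable_EFinP; apply: measurableT_comp => //; exact: measurable_funM.
  rewrite [leRHS]muleC; apply: lee_pmul => //; first exact: integral_ge0.
  by under eq_integral do rewrite mulrC; exact: gram_cross_le.
Qed.

Let h2i y : (rho \x nu)%E.-integrable setT (EFin \o (fun w => e (w.1, y) * (e w * a w.2))).
Proof.
apply/(integrable12ltyP rho nu).
  by apply/measurable_EFinP; exact: mh2.
exact: le_lt_trans (tonelli2 y) (ltry _).
Qed.

Lemma integrable_gram_section t :
  nu.-integrable setT (EFin \o (fun y => e (t, y) * a y)).
Proof. exact: (integrable_bounded_mulr (M := M)). Qed.

Let mB : measurable_fun setT B.
Proof.
apply: (measurable_Rintegral_param nu (h := fun w => e w * a w.2)).
by apply: measurable_funM => //; exact: measurableT_comp.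
Qed.

Let BeE y : \int[rho]_t (e (t, y) * B t) = \int[nu]_z (a z * G y z).
Proof.
transitivity (\int[rho]_t \int[nu]_z (e (t, y) * (e (t, z) * a z))).
  apply: eq_Rintegral => t _; rewrite RintegralZl//.
  exact: integrable_gram_section.
rewrite (Rintegral_prod1 (h2i y)) -(Rintegral_prod2 (h2i y)).
apply: eq_Rintegral => z _ /=; rewrite /G -RintegralZl//.
  by apply: eq_Rintegral => t _; ring.
exact: integrable_gram_cross.
Qed.

Let Be_le y : (\int[rho]_t `|e (t, y) * B t|%:E <= (M * A1)%:E)%E.
Proof.
apply: le_trans (tonelli2 y); apply: ge0_le_integral => //.
- by apply/measurable_EFinP; apply: measurableT_comp => //; exact: measurable_funM.
- apply: (measurable_fun_fubini_tonelli_F (fun w => `|e (w.1, y) * (e w * a w.2)|%:E)) => //.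
  by apply/measurable_EFinP; apply: measurableT_comp => //; exact: mh2.
- move=> t _ /=; rewrite normrM.
  under eq_integral do rewrite normrM EFinM.
  rewrite ge0_integralZl_EFin//; last first.
    by apply/measurable_EFinP; apply: measurableT_comp => //; exact: measurable_funM.
  rewrite EFinM lee_pmul//.
  rewrite EFin_normr_Rintegral//; last exact: integrable_gram_section.
  by apply: le_abse_integral => //; exact: measurable_int (integrable_gram_section t).
Qed.

Let integrable_gram_B y :
  rho.-integrable setT (EFin \o (fun t => e (t, y) * B t)).
Proof.
apply/integrableP; split.
  by apply/measurable_EFinP; exact: measurable_funM.
exact: le_lt_trans (Be_le y) (ltry _).
Qed.

Let mh1 : measurable_fun setT (fun w : T * Y => B w.1 * (e w * a w.2)).
Proof.
apply: measurable_funM; first exact: measurableT_comp.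
by apply: measurable_funM => //; exact: measurableT_comp.
Qed.

Let h1i : (rho \x nu)%E.-integrable setT (EFin \o (fun w => B w.1 * (e w * a w.2))).
Proof.
(* With y fixed, the integral of |e B| is at most M times the L^1 norm of a; the weight |a y|
   contributes that norm a second time. *)
apply/(integrable21ltyP rho nu); first exact/measurable_EFinP.
apply: (@le_lt_trans _ _ (\int[nu]_y ((M * A1)%:E * `|a y|%:E))%E); last first.
  rewrite ge0_integralZl_EFin//; last 2 first.
  - by apply/measurable_EFinP; exact: measurableT_comp.
  - by rewrite mulr_ge0// /A1 Rintegral_ge0.
  by rewrite A1E -EFinM ltry.
have mna : measurable_fun setT (fun z => `|a z|%:E).
  by apply/measurable_EFinP; exact: measurableT_comp.
apply: ge0_le_integral => //.
- by move=> z _; exact: integral_ge0.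
- apply: (measurable_fun_fubini_tonelli_G (fun w => `|B w.1 * (e w * a w.2)|%:E)) => //.
  by apply/measurable_EFinP; apply: measurableT_comp => //; exact: mh1.
- exact: measurable_funeM.
- move=> y _ /=.
  under eq_integral do rewrite mulrA mulrC normrM EFinM.
  rewrite ge0_integralZl_EFin//; last first.
    by apply/measurable_EFinP; apply: measurableT_comp => //; exact: measurable_funM.
  rewrite [leRHS]muleC; apply: lee_pmul => //; first exact: integral_ge0.
  by under eq_integral do rewrite mulrC; exact: Be_le.
Qed.

Lemma integrable_gram1 y :
  nu.-integrable setT (EFin \o (fun z => a z * G y z)).
Proof.
apply: (eq_integrable measurableT (EFin \o (fun z => G y z * a z))).
  by move=> z _ /=; rewrite mulrC.
apply: (integrable_bounded_mulr (M := M)) => //.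
- apply: (measurable_Rintegral_param2 rho (h := fun w => e (w.1, y) * e w)).
  apply: measurable_funM => //.
  by apply: (measurableT_comp me (g := fun w : T * Y => (w.1, y))); exact: measurable_fun_pair.
- move=> z; rewrite -lee_fin EFin_normr_Rintegral//; last exact: integrable_gram_cross.
  apply: le_trans (gram_cross_le y z); apply: le_abse_integral => //.
  exact: measurable_int (integrable_gram_cross y z).
Qed.

Lemma integrable_gram2 :
  nu.-integrable setT (EFin \o (fun y => a y * \int[nu]_z (a z * G y z))).
Proof.
apply: eq_integrable (integrable_Rintegral2 h1i) => // y _ /=.
congr EFin; rewrite -BeE -[RHS]RintegralZl//.
by apply: eq_Rintegral => t _; ring.
Qed.

(** One factor of B^2 is expanded and the integrals exchanged, then the other. Two applications of
    Fubini on a product of two spaces thus replace one on a triple product. *)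
Lemma gram_identity :
  rho.-integrable setT (EFin \o (fun t => B t ^+ 2)) /\
  \int[rho]_t (B t ^+ 2) = \int[nu]_y (a y * \int[nu]_z (a z * G y z)).
Proof.
have BB : (fun t => B t ^+ 2) = (fun t => \int[nu]_y (B t * (e (t, y) * a y))).
  by apply/funext => t; rewrite RintegralZl//; exact: integrable_gram_section.
rewrite BB; split; first exact: (integrable_Rintegral1 h1i).
rewrite (Rintegral_prod1 h1i) -(Rintegral_prod2 h1i).
apply: eq_Rintegral => y _ /=; rewrite -BeE -RintegralZl//.
by apply: eq_Rintegral => t _; ring.
Qed.

End gram.

(** * Plancherel inequalities on the line *)

Section trigonometric_bounds.
Context {R : realType}.
Implicit Types u v : R.

Lemma sin_mvt v : 0 <= v -> exists2 c, 0 <= c <= v & sin v = v * cos c.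
Proof.
move=> v0; have [|c cv] := @MVT_segment R sin cos 0 v v0 (fun x _ => is_derive_sin x).
  by apply: continuous_subspaceT => x; exact: continuous_sin.
by rewrite sin0 !subr0 mulrC => ->; exists c.
Qed.

Lemma sqr_sin_le v : sin v ^+ 2 <= v ^+ 2.
Proof.
wlog v0 : v / 0 <= v => [H|].
  have [v0|v0] := leP 0 v; first exact: H.
  by rewrite -(sqrrN v) -sqrrN -sinN H// oppr_ge0 ltW.
have [c _ ->] := sin_mvt v0.
rewrite exprMn ler_piMr ?sqr_ge0// -real_normK ?num_real// expr_le1//.
Qed.

Lemma cos_half_gt0 : 0 < cos (2^-1 : R).
Proof.
apply: cos_gt0_pihalf; have := @pi_ge2 R; lra.
Qed.

(** By the mean value theorem sin v = v cos c with c between 0 and v, and the cosine decreases from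
    0 to 1 / 2, which is below pi / 2. *)
Lemma sqr_sin_ge v : `|v| <= 2^-1 -> cos 2^-1 ^+ 2 * v ^+ 2 <= sin v ^+ 2.
Proof.
wlog v0 : v / 0 <= v => [H|].
  have [v0|v0 v1] := leP 0 v; first exact: H.
  by rewrite -(sqrrN v) -(sqrrN (sin v)) -sinN H ?normrN// oppr_ge0 ltW.
rewrite ger0_norm// => v1; have [c /andP[c0 cv] ->] := sin_mvt v0.
have p2 := @pi_ge2 R.
have cc0 : 0 < cos c by apply: cos_gt0_pihalf; lra.
have cc : cos 2^-1 <= cos c.
  have [->//|cn] := eqVneq c 2^-1.
  have lc : c < 2^-1 by rewrite lt_neqAle cn; lra.
  by apply/ltW; rewrite ltr_cos ?in_itv//=; apply/andP; split; lra.
by rewrite exprMn mulrC ler_wpM2l ?sqr_ge0// ler_pXn2r ?nnegrE// ltW// cos_half_gt0.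
Qed.

Lemma one_sub_cosE u : 1 - cos u = 2 * sin (u / 2) ^+ 2.
Proof.
have -> : cos u = cos ((u / 2) *+ 2) by congr cos; rewrite mulr2n; lra.
by rewrite cos_mulr2n sin2cos2 mulr2n; ring.
Qed.

Lemma one_sub_cos_ge0 u : 0 <= 1 - cos u.
Proof. by rewrite subr_ge0 cos_le1. Qed.

Lemma one_sub_cos_le u : 1 - cos u <= u ^+ 2 / 2.
Proof. by rewrite one_sub_cosE; have := sqr_sin_le (u / 2); lra. Qed.

Lemma one_sub_cos_ge u : `|u| <= 1 -> cos 2^-1 ^+ 2 / 2 * u ^+ 2 <= 1 - cos u.
Proof.
move=> u1; rewrite one_sub_cosE.
have /sqr_sin_ge : `|u / 2| <= 2^-1 by rewrite normrM (@ger0_norm _ 2^-1)//; lra.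
by lra.
Qed.

End trigonometric_bounds.

(** * Change of variables and the cosine kernel *)

Section lebesgue_change_of_variables.
Context {R : realType}.
Local Notation mu := (@lebesgue_measure R).
Implicit Types f : measurableTypeR R -> \bar R.

Lemma measurable_scale (h : R) :
  measurable_fun setT ( *%R h : measurableTypeR R -> measurableTypeR R).
Proof. by apply: measurable_funM. Qed.

Let scaled (h : {nonneg R}) : {measure set (measurableTypeR R) -> \bar R} :=
  mscale h (measure_function_pushforward__canonical__measure_function_Measure
    mu (measurable_scale h%:num)).

(** The image of Lebesgue measure under multiplication by h, rescaled by h, has the right value on
    half-open intervals, hence is Lebesgue measure by uniqueness. *)
Lemma ge0_integral_scale f (h : R) : 0 < h -> measurable_fun setT f ->
  (forall x, 0 <= f x)%E ->
  (h%:E * \int[mu]_x f (h * x)%R = \int[mu]_x f x)%E.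
Proof.
move=> h0 mf f0; pose hn := NngNum (ltW h0).
rewrite [RHS](@eq_measure_integral _ _ _ setT (scaled hn)); last first.
  move=> A mA _; apply: lebesgue_measure_unique => // _ [[a b]] _ <-.
  rewrite /scaled/= /mscale/=.
  rewrite [X in (_ * X)%E](_ : _ = mu `](a / h), (b / h)]); last first.
    rewrite /pushforward; congr (mu _); apply/seteqP; split => x /=;
    by rewrite !in_itv/= ltr_pdivrMr// ler_pdivlMr// mulrC.
  rewrite !lebesgue_measure_itv/= !lte_fin ltr_pM2r ?invr_gt0//.
  case: ifPn => // _; last by rewrite mule0.
  by rewrite -!EFinD -EFinM; congr EFin; field; rewrite gt_eqF.
by rewrite /scaled ge0_integral_mscale//= ge0_integral_pushforward.
Qed.

Lemma ge0_integral_reflect f : measurable_fun setT f ->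
  (forall x, 0 <= f x)%E -> (\int[mu]_x f (- x)%R = \int[mu]_x f x)%E.
Proof.
move=> mf f0.
have mN : measurable_fun setT (-%R : measurableTypeR R -> measurableTypeR R).
  exact: oppr_measurable.
transitivity (\int[pushforward mu (-%R : measurableTypeR R -> measurableTypeR R)]_x f x)%E.
  by rewrite ge0_integral_pushforward.
by apply: eq_measure_integral => A mA _; exact: lebesgue_measureN.
Qed.

End lebesgue_change_of_variables.

Section cosine_kernel.
Context {R : realType}.
Local Notation mu := (@lebesgue_measure R).
Implicit Types h xi : R.

(* Equal to 0 at xi = 0, by the convention x / 0 = 0. *)
Definition cosker h xi : R := (1 - cos (h * xi)) / xi ^+ 2.

Lemma cosker_ge0 h xi : 0 <= cosker h xi.
Proof. by rewrite divr_ge0 ?one_sub_cos_ge0 ?sqr_ge0. Qed.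

Lemma cosker_le h xi : cosker h xi <= h ^+ 2 / 2.
Proof.
rewrite /cosker; have [->|xi0] := eqVneq xi 0.
  by rewrite expr0n invr0 mulr0 divr_ge0 ?sqr_ge0.
rewrite ler_pdivrMr ?exprn_even_gt0//.
by have := one_sub_cos_le (h * xi); rewrite exprMn; lra.
Qed.

Lemma measurable_cosker h : measurable_fun setT (cosker h).
Proof.
apply: measurable_funM.
  apply: measurable_funB => //.
  by apply: (measurableT_comp measurable_cos); exact: measurable_funM.
rewrite (_ : (fun xi => _) = fun xi => (xi ^+ 2) `^ (-1)); last first.
  by apply/funext => xi; rewrite powR_inv1// sqr_ge0.
by apply: (measurableT_comp (measurable_powR _)); exact: measurable_funX.
Qed.

Lemma integral_cosker1_lty : (\int[mu]_xi (cosker 1 xi)%:E < +oo)%E.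
Proof.
have c0 x : 0 <= (oneDsqr x)^-1 :> R by rewrite invr_ge0 ltW// oneDsqr_gt0.
have cc : continuous (fun x => (oneDsqr x)^-1 : R) by exact: continuous_oneDsqrV.
(* The numerator is at most both xi^2 / 2 and 2; multiplied by 1 + xi^2 it is therefore at most 5 /
   2 times xi^2. *)
apply: (@le_lt_trans _ _ (\int[mu]_xi (4%:E * (oneDsqr xi)^-1%:E))%E).
  apply: ge0_le_integral => //.
  - by move=> xi _; rewrite lee_fin cosker_ge0.
  - by apply/measurable_EFinP; exact: measurable_cosker.
  - by apply: measurable_funeM; apply/measurable_EFinP; exact: continuous_measurable_fun.
  - move=> xi _; rewrite -EFinM lee_fin /cosker /oneDsqr.
    have [->|xi0] := eqVneq xi 0.
      by rewrite expr0n invr0 mulr0 mulr_ge0// invr_ge0 addr0.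
    have x2 : 0 < xi ^+ 2 by rewrite exprn_even_gt0.
    rewrite mul1r ler_pdivrMr// -mulrA mulrC -mulrA mulrC ler_pdivlMr; last lra.
    have := one_sub_cos_le xi; have := cos_geN1 xi; have := one_sub_cos_ge0 xi.
    by nra.
rewrite ge0_integralZl_EFin//; last first.
  by apply/measurable_EFinP; exact: continuous_measurable_fun.
rewrite ge0_symfun_integralT//; last by move=> x; rewrite /= /oneDsqr sqrrN.
rewrite [X in (_ * (_ * X))%E](_ : _ = (pi / 2)%:E).
  by rewrite -!EFinM ltry.
rewrite -integral0y_oneDsqr; congr (integral _ _ _).
by apply/seteqP; split => x /=; rewrite in_itv/= andbT.
Qed.

(** The kernel at h is h^2 times the kernel at 1 evaluated at h xi, and the substitution removes one
    factor h. The constant is positive because the kernel at 1 is bounded below on the unit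
    interval. *)
Lemma integral_cosker : exists2 c : R, 0 < c &
  forall h, (\int[mu]_xi (cosker h xi)%:E = (c * `|h|)%:E)%E.
Proof.
have D1 : (\int[mu]_xi (cosker 1 xi)%:E)%E \is a fin_num.
  rewrite ge0_fin_numE ?integral_cosker1_lty//.
  by apply: integral_ge0 => xi _; rewrite lee_fin cosker_ge0.
exists (fine (\int[mu]_xi (cosker 1 xi)%:E)%E).
  rewrite fine_gt0// -ge0_fin_numE; last first.
    by apply: integral_ge0 => xi _; rewrite lee_fin cosker_ge0.
  rewrite D1 andbT; pose k : R := cos 2^-1 ^+ 2 / 2.
  have k0 : 0 < k by rewrite divr_gt0// exprn_gt0// cos_half_gt0.
  apply: (@lt_le_trans _ _ (\int[mu]_(xi in `]0%R, 1%R]) (cst k%:E xi))%E).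
    by rewrite integral_cst//= lebesgue_measure_itv/= lte_fin ltr01 sube0 mule1 lte_fin.
  apply: (@le_trans _ _ (\int[mu]_(xi in `]0%R, 1%R]) (cosker 1 xi)%:E)%E).
    apply: ge0_le_integral => //.
    - by move=> xi _; rewrite lee_fin ltW.
    - by apply/measurable_EFinP/measurable_funTS; exact: measurable_cosker.
    - move=> xi /=; rewrite in_itv/= => /andP[x0 x1]; rewrite lee_fin /cosker mul1r.
      rewrite ler_pdivlMr ?exprn_gt0//; apply: one_sub_cos_ge.
      by rewrite ger0_norm// ltW.
  apply: ge0_subset_integral => //.
  - by apply/measurable_EFinP; exact: measurable_cosker.
  - by move=> xi _; rewrite lee_fin cosker_ge0.
move=> h.
wlog h0 : h / 0 <= h => [H|].
  have [h0|h0] := leP 0 h; first exact: H.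
  rewrite -normrN -H ?oppr_ge0 ?ltW//; apply: eq_integral => xi _.
  by rewrite /cosker mulNr cosN.
have [->|hn0] := eqVneq h 0.
  by rewrite normr0 mulr0 integral0_eq// => xi _; rewrite /cosker mul0r cos0 subrr mul0r.
have {hn0}h0 : 0 < h by rewrite lt_neqAle eq_sym hn0.
rewrite gtr0_norm// mulrC EFinM fineK// -(@ge0_integral_scale _ (fun xi => (cosker 1 xi)%:E) h)//.
- rewrite muleA -EFinM -ge0_integralZl_EFin//.
  + apply: eq_integral => xi _; rewrite -EFinM; congr EFin.
    rewrite /cosker mul1r; have [->|xi0] := eqVneq xi 0.
      by rewrite !(mulr0, expr0n, invr0).
    by rewrite -expr2; field; rewrite xi0 gt_eqF.
  + by move=> xi _; rewrite lee_fin cosker_ge0.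
  + apply/measurable_EFinP; apply: (measurableT_comp (measurable_cosker 1)).
    exact: measurable_funM.
  + by rewrite mulr_ge0// ltW.
- by apply/measurable_EFinP; exact: measurable_cosker.
- by move=> xi; rewrite lee_fin cosker_ge0.
Qed.

End cosine_kernel.

Section box_kernel.
Context {R : realType}.
Local Notation mu := (@lebesgue_measure R).
Local Notation RR := (measurableTypeR R).

Definition box (r : R) (z : RR * RR) : R :=
  \1_[set z : RR * RR | `|z.1 - z.2| < r] z.

Lemma box_ge0 r z : 0 <= box r z.
Proof. by rewrite /box indicE. Qed.

Lemma box_norm_le1 r z : `|box r z| <= 1.
Proof. by rewrite /box indicE; case: (_ \in _); rewrite ?normr1 ?normr0. Qed.

Lemma box_sqr r z : box r z ^+ 2 = box r z.
Proof. by rewrite /box indicE; case: (_ \in _); rewrite ?expr1n ?expr0n. Qed.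

Lemma boxE r x y : box r (x, y) = \1_(ball x r : set R) y.
Proof. by rewrite /box !indicE; congr (nat_of_bool _)%:R; apply/idP/idP; rewrite !inE. Qed.

Lemma measurable_box r : measurable_fun setT (box r).
Proof.
apply: measurable_indic.
have mn : measurable_fun setT (fun z : RR * RR => `|z.1 - z.2|).
  by apply: measurableT_comp => //; exact: measurable_funB.
have := mn measurableT _ (measurable_itv `]-oo, r[).
by rewrite setTI; congr (measurable _); apply/seteqP; split => z /=; rewrite in_itv.
Qed.

(** Two intervals of radius r around y and z overlap on a length given by this tent function, the
    same one that [Rintegral_cosker_cos] produces from the cosine kernel. *)
Lemma integral_box_mul r y z : 0 < r ->
  (\int[mu]_x (box r (x, y) * box r (x, z))%:E =
   (Num.max 0 (2 * r - `|y - z|))%:E)%E.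
Proof.
move=> r0.
wlog yz : y z / y <= z => [H|].
  have [yz|/ltW zy] := leP y z; first exact: H.
  by rewrite distrC -H//; apply: eq_integral => x _; rewrite mulrC.
have -> : `|y - z| = z - y by rewrite distrC ger0_norm ?subr_ge0.
transitivity (\int[mu]_x (\1_(`](z - r), (y + r)[%classic : set R) x)%:E)%E.
  apply: eq_integral => x _; congr EFin; rewrite /box !indicE -natrM mulnb.
  congr (nat_of_bool _)%:R; apply/idP/idP => [/andP[]|].
    rewrite !inE /= in_itv/= !ltr_distl => /andP[? ?] /andP[? ?].
    by apply/andP; split; lra.
  rewrite inE/= in_itv/= => /andP[? ?].
  by apply/andP; split; rewrite inE/= ltr_distl; apply/andP; split; lra.
rewrite integral_indic//= setIT lebesgue_measure_itv/= lte_fin.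
have [h|h] := ltP (z - r) (y + r).
  by rewrite -EFinD; congr EFin; rewrite max_r; lra.
by rewrite max_l//; lra.
Qed.

End box_kernel.

Section box_identity.
Context {R : realType}.
Local Notation mu := (@lebesgue_measure R).
Local Notation RR := (measurableTypeR R).
Variable c : R.
Hypothesis c0 : 0 < c.
Hypothesis coskerE : forall h, (\int[mu]_xi (cosker h xi)%:E = (c * `|h|)%:E)%E.

Lemma integrable_cosker h : mu.-integrable setT (EFin \o cosker h).
Proof.
apply/integrableP; split; first by apply/measurable_EFinP; exact: measurable_cosker.
rewrite (_ : (\int[mu]_x _)%E = (\int[mu]_xi (cosker h xi)%:E)%E).
  by rewrite coskerE ltry.
by apply: eq_integral => xi _ /=; rewrite ger0_norm ?cosker_ge0.
Qed.

(** The product formula for cosines writes the integrand as the half-sum of the kernels at h + w and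
    h - w minus the kernel at w. The tent is then (|h + w| + |h - w|) / 2 - |w|. *)
Lemma Rintegral_cosker_cos h w : 0 <= h ->
  \int[mu]_xi (cosker h xi * cos (w * xi)) = c * Num.max 0 (h - `|w|).
Proof.
move=> h0.
have ki u s : mu.-integrable setT (EFin \o (fun xi => s * cosker u xi)).
  by apply: (eq_integrable measurableT) (integrableZl measurableT s (integrable_cosker u)) => x _.
have kE u s : \int[mu]_xi (s * cosker u xi) = s * (c * `|u|).
  by rewrite RintegralZl ?/Rintegral ?coskerE//; exact: integrable_cosker.
transitivity (\int[mu]_xi (2^-1 * cosker (h + w) xi +
    (2^-1 * cosker (h - w) xi + -1 * cosker w xi))).
  apply: eq_Rintegral => xi _; rewrite /cosker.
  by rewrite [(h + w) * xi]mulrDl [(h - w) * xi]mulrBl cosD cosB; move: (xi ^- 2) => v; field.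
rewrite RintegralD//; last exact: integrable_add.
rewrite RintegralD// !kE.
wlog w0 : w / 0 <= w => [H|].
  have [w0|w0] := leP 0 w; first exact: H.
  have /H : 0 <= - w by rewrite oppr_ge0 ltW.
  by rewrite opprK normrN => <-; ring.
rewrite (ger0_norm w0) (@ger0_norm _ (h + w)) ?addr_ge0//.
have [hw|hw] := leP w h.
  by rewrite ger0_norm ?subr_ge0// max_r ?subr_ge0//; field.
by rewrite ltr0_norm ?subr_lt0// max_l ?subr_le0 ?ltW//; field.
Qed.

Variable r : R.
Hypothesis r0 : 0 < r.
Variable a : R -> R.
Hypothesis ai : mu.-integrable setT (EFin \o a).

(** One bound for both hypotheses of the Gram identity, for the boxes and for the weighted
    trigonometric functions. For the latter, the square root of a kernel k <= 2 r^2 is at most 1 +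
    k, and the squares have integral at most 2 r c. *)
Let M : R := 1 + 2 * r + 2 * r ^+ 2 + c * (2 * r).
Let M0 : 0 <= M.
Proof. by rewrite /M !addr_ge0 ?mulr_ge0 ?sqr_ge0// ltW. Qed.

(** The square root puts the cosine kernel itself into the Gram function; g is the cosine or the
    sine. *)
Let e (g : R -> R) (z : RR * RR) : R := Num.sqrt (cosker (2 * r) z.1) * g (z.2 * z.1).

Section trigonometric_frame.
Variable g : R -> R.
Hypothesis mg : measurable_fun setT g.
Hypothesis g1 : forall x, `|g x| <= 1.

Let me : measurable_fun setT (e g).
Proof.
apply: measurable_funM; last first.
  by apply: (measurableT_comp mg); exact: measurable_funM.
have ms : measurable_fun setT (@Num.sqrt R).
  by apply: continuous_measurable_fun; exact: sqrt_continuous.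
have mk : measurable_fun setT (fun z : RR * RR => cosker (2 * r) z.1).
  exact: (measurableT_comp (measurable_cosker (2 * r))).
exact: (measurableT_comp ms mk).
Qed.

Let eM z : `|e g z| <= M.
Proof.
rewrite /e normrM (ger0_norm (sqrtr_ge0 _)).
have := cosker_le (2 * r) z.1; set k := cosker _ _ => kr.
have k0 : 0 <= k by exact: cosker_ge0.
have sk : Num.sqrt k <= 1 + k.
  rewrite -[leRHS]ger0_norm ?addr_ge0// -sqrtr_sqr ler_wsqrtr//; nra.
apply: (@le_trans _ _ (Num.sqrt k * 1)); first by rewrite ler_wpM2l ?sqrtr_ge0.
rewrite mulr1 (le_trans sk)// /M.
have cr : 0 < c * (2 * r) by rewrite !mulr_gt0.
by rewrite exprMn in kr; have := r0; lra.
Qed.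

Let e2M y : (\int[mu]_t (e g (t, y) ^+ 2)%:E <= M%:E)%E.
Proof.
apply: (@le_trans _ _ (\int[mu]_t (cosker (2 * r) t)%:E)%E).
  apply: ge0_le_integral => //.
  - by move=> t _; rewrite lee_fin sqr_ge0.
  - apply/measurable_EFinP; apply: measurable_funX.
    exact: (measurableT_comp me (pair2_measurable y)).
  - by apply/measurable_EFinP; exact: measurable_cosker.
  - move=> t _; rewrite lee_fin exprMn sqr_sqrtr ?cosker_ge0//.
    by rewrite ler_piMr ?cosker_ge0// -real_normK ?num_real// expr_le1.
rewrite coskerE lee_fin /M ger0_norm ?mulr_ge0// 1?ltW//.
have : 0 <= 2 * r ^+ 2 by rewrite mulr_ge0 ?sqr_ge0.
by have := r0; lra.
Qed.

Let frame_gram := gram_identity (rho := mu) (nu := mu) me M0 eM e2M ai.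
Let frame_i1 := integrable_gram1 (rho := mu) (nu := mu) me e2M ai.
Let frame_i2 := integrable_gram2 (rho := mu) (nu := mu) me M0 eM e2M ai.
Let frame_cross := integrable_gram_cross (rho := mu) me e2M.

Let frame_sqr xi : (\int[mu]_y (e g (xi, y) * a y)) ^+ 2 =
  cosker (2 * r) xi * (\int[mu]_y (g (y * xi) * a y)) ^+ 2.
Proof.
rewrite -[X in X * _]sqr_sqrtr ?cosker_ge0// -exprMn; congr (_ ^+ 2).
rewrite -RintegralZl//; first by apply: eq_Rintegral => y _; rewrite /e/= mulrA.
apply: (integrable_bounded_mulr (M := 1)) => //.
by apply: (measurableT_comp mg); exact: measurable_funM.
Qed.

Lemma trigonometric_gram : let G y z := \int[mu]_t (e g (t, y) * e g (t, z)) in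
  let B xi := cosker (2 * r) xi * (\int[mu]_y (g (y * xi) * a y)) ^+ 2 in
  [/\ forall y z, mu.-integrable setT (EFin \o (fun t => e g (t, y) * e g (t, z))),
      forall y, mu.-integrable setT (EFin \o (fun z => a z * G y z)),
      mu.-integrable setT (EFin \o (fun y => a y * \int[mu]_z (a z * G y z))),
      mu.-integrable setT (EFin \o B) &
      \int[mu]_xi B xi = \int[mu]_y (a y * \int[mu]_z (a z * G y z))].
Proof.
move=> G B; have BE : B = (fun xi => (\int[mu]_y (e g (xi, y) * a y)) ^+ 2).
  by apply/funext => xi; rewrite frame_sqr.
by rewrite BE; have [? ?] := frame_gram; split.
Qed.

End trigonometric_frame.

Let cosT xi : R := \int[mu]_y (cos (y * xi) * a y).
Let sinT xi : R := \int[mu]_y (sin (y * xi) * a y).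

(** Both sides are quadratic forms in a given by Gram functions. On the frequency side the cosine
    and sine families add up, through cos cos + sin sin = cos of the difference, to c times the tent
    function, which is the Gram function of the boxes. *)
Lemma box_fourier_identity :
  [/\ mu.-integrable setT (EFin \o (fun x => (\int[mu]_y (box r (x, y) * a y)) ^+ 2)),
      mu.-integrable setT
        (EFin \o (fun xi => cosker (2 * r) xi * (cosT xi ^+ 2 + sinT xi ^+ 2))) &
      c * \int[mu]_x (\int[mu]_y (box r (x, y) * a y)) ^+ 2 =
      \int[mu]_xi (cosker (2 * r) xi * (cosT xi ^+ 2 + sinT xi ^+ 2))].
Proof.
have [C1 C2 C3 C4 C5] := trigonometric_gram measurable_cos (@cos_max R).
have [S1 S2 S3 S4 S5] := trigonometric_gram measurable_sin (@sin_max R).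
have bM z : `|box r z| <= 1 + 2 * r.
  by rewrite (le_trans (box_norm_le1 _ _))// lerDl mulr_ge0// ltW.
have r20 : 0 <= 2 * r by rewrite mulr_ge0// ltW.
have b2 y : (\int[mu]_x (box r (x, y) ^+ 2)%:E <= (1 + 2 * r)%:E)%E.
  under eq_integral do rewrite expr2.
  by rewrite integral_box_mul// subrr normr0 subr0 max_r// lee_fin lerDr.
have M1 : 0 <= 1 + 2 * r by rewrite addr_ge0.
have [B1 B2] := gram_identity (rho := mu) (nu := mu) (measurable_box r) M1 bM b2 ai.
have B3 := integrable_gram1 (rho := mu) (nu := mu) (measurable_box r) b2 ai.
have B4 := integrable_gram2 (rho := mu) (nu := mu) (measurable_box r) M1 bM b2 ai.
have kE : (fun xi => cosker (2 * r) xi * (cosT xi ^+ 2 + sinT xi ^+ 2)) =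
    fun xi => cosker (2 * r) xi * cosT xi ^+ 2 + cosker (2 * r) xi * sinT xi ^+ 2.
  by apply/funext => xi; rewrite mulrDr.
split => //; rewrite kE; first exact: integrable_add.
rewrite [RHS](RintegralD measurableT C4 S4) C5 S5 B2.
rewrite -(RintegralD measurableT C3 S3) -(@RintegralZl _ _ _ mu _ _ c measurableT B4).
apply: eq_Rintegral => y _; rewrite -mulrDr -(RintegralD measurableT (C2 y) (S2 y)).
rewrite mulrCA -(@RintegralZl _ _ _ mu _ _ c measurableT (B3 y)); congr (_ * _).
apply: eq_Rintegral => z _; rewrite -mulrDr mulrCA; congr (_ * _).
rewrite -(RintegralD measurableT (C1 y z) (S1 y z)).
rewrite {1}/Rintegral (integral_box_mul y z r0)/= -(Rintegral_cosker_cos (y - z) r20).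
apply: eq_Rintegral => xi _; rewrite /e/= mulrBl cosB.
by rewrite -[X in X * _](sqr_sqrtr (cosker_ge0 _ _)); ring.
Qed.

End box_identity.

Section fatou_bound.
Context d (T : measurableType d) (R : realType).
Variable mu : {measure set T -> \bar R}.
Local Open Scope ereal_scope.

Lemma ae_imply (P Q : T -> Prop) : (forall x, P x -> Q x) ->
  {ae mu, forall x, P x} -> {ae mu, forall x, Q x}.
Proof. by move=> PQ; apply: filterS. Qed.

Lemma ge0_integrable_EFin (f : T -> R) :
  (forall x, (0 <= f x)%R) -> measurable_fun setT f ->
  \int[mu]_x (f x)%:E < +oo -> mu.-integrable setT (EFin \o f).
Proof.
move=> f0 mf fi; apply/integrableP; split; first exact/measurable_EFinP.
by under eq_integral => x _ do rewrite /= ger0_norm//.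
Qed.

Lemma limn_einf_ge (u : (\bar R)^nat) m N :
  (forall n, (N <= n)%N -> m <= u n) -> m <= limn_einf u.
Proof.
move=> mu_; rewrite limn_einf_lim; apply: lime_ge; first exact: is_cvg_einfs.
near=> n; apply: le_ereal_inf_tmp => _ [k /= nk <-]; apply: mu_.
by rewrite (leq_trans _ nk)//; near: n; exists N.
Unshelve. all: by end_near. Qed.

Lemma limn_einf_le (u : (\bar R)^nat) M :
  (forall n, u n <= M) -> limn_einf u <= M.
Proof.
move=> uM; rewrite limn_einf_lim; apply: lime_le; first exact: is_cvg_einfs.
by apply: nearW => n; apply: le_trans (uM n); apply: ereal_inf_lbound; exists n => /=.
Qed.

(** The form of Fatou's lemma in which the radius tends to 0, once in space and once in frequency;
    the lower bound on the limit may fail on a null set. *)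
Lemma fatou_le (f : (T -> \bar R)^nat) (g : T -> \bar R) M :
  (forall n, measurable_fun setT (f n)) -> (forall n x, 0 <= f n x) ->
  measurable_fun setT g -> (forall x, 0 <= g x) ->
  {ae mu, forall x, g x <= limn_einf (f ^~ x)} ->
  (forall n, \int[mu]_x f n x <= M) -> \int[mu]_x g x <= M.
Proof.
move=> mf f0 mg g0 gf fM.
apply: (@le_trans _ _ (\int[mu]_x limn_einf (f ^~ x))).
  apply: ge0_ae_le_integral => //.
    apply: (measurableT_comp (f := -%E)); first exact: oppe_measurable.
    apply: (measurable_fun_limn_esup (f := fun n x => - f n x)) => n.
    by apply: measurableT_comp => //; exact: oppe_measurable.
  by move=> x; apply: (@limn_einf_ge _ _ 0).
by apply: (le_trans (fatou _ _ _ _)) => //; exact: limn_einf_le.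
Qed.

End fatou_bound.

Section plancherel_real_line.
Context {R : realType}.
Local Notation mu := (@lebesgue_measure R).
Local Notation RR := (measurableTypeR R).
Implicit Types (a : R -> R) (r x : R).

Definition costransform a xi : R := \int[mu]_y (cos (y * xi) * a y).
Definition sintransform a xi : R := \int[mu]_y (sin (y * xi) * a y).

Let phase : RR -> RR -> R := fun y xi => y * xi.

Let mphase : measurable_fun setT (fun z : RR * RR => phase z.1 z.2).
Proof. exact: measurable_funM. Qed.

Lemma measurable_costransform a : measurable_fun setT a ->
  measurable_fun setT (costransform a).
Proof.
move=> ma; apply: (@measurable_Rintegral_param2 _ _ _ _ _ mu
  (fun z : RR * RR => cos (phase z.1 z.2) * a z.1)).
apply: measurable_funM; first exact: (measurableT_comp measurable_cos mphase).
exact: measurableT_comp.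
Qed.

Lemma measurable_sintransform a : measurable_fun setT a ->
  measurable_fun setT (sintransform a).
Proof.
move=> ma; apply: (@measurable_Rintegral_param2 _ _ _ _ _ mu
  (fun z : RR * RR => sin (phase z.1 z.2) * a z.1)).
apply: measurable_funM; first exact: (measurableT_comp measurable_sin mphase).
exact: measurableT_comp.
Qed.

Let mbox1 r x : measurable_fun setT (fun y => box r (x, y)).
Proof. exact: (measurableT_comp (measurable_box r) (pair1_measurable x)). Qed.

Let boxC r x y : box r (x, y) = box r (y, x).
Proof. by rewrite /box !indicE; congr (nat_of_bool _)%:R; apply/idP/idP; rewrite !inE/= distrC. Qed.

Lemma integral_box1 r x : 0 < r -> (\int[mu]_y (box r (x, y))%:E = (2 * r)%:E)%E.
Proof.
move=> r0; under eq_integral do rewrite boxC -box_sqr expr2.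
by rewrite integral_box_mul// subrr normr0 subr0 max_r// mulr_ge0// ltW.
Qed.

Lemma integrable_box a r x : mu.-integrable setT (EFin \o a) ->
  mu.-integrable setT (EFin \o (fun y => box r (x, y) * a y)).
Proof.
move=> ai; apply: (integrable_bounded_mulr (M := 1)) => // y.
exact: box_norm_le1.
Qed.

(** Expand box * (a - m)^2 >= 0 and integrate, with m the average of a over the interval. When a is
    not square integrable there, the right-hand side is infinite. *)
Lemma box_jensen a r x : 0 < r -> mu.-integrable setT (EFin \o a) ->
  (((\int[mu]_y (box r (x, y) * a y)) ^+ 2)%:E <=
   (2 * r)%:E * \int[mu]_y (box r (x, y) * a y ^+ 2)%:E)%E.
Proof.
move=> r0 ai; have ma := integrable_measurable ai.
have r20 : 0 < 2 * r by rewrite mulr_gt0.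
have q0 y : (0 <= (box r (x, y) * a y ^+ 2)%:E)%E.
  by rewrite lee_fin mulr_ge0 ?box_ge0 ?sqr_ge0.
have mq : measurable_fun setT (fun y => (box r (x, y) * a y ^+ 2)%:E).
  by apply/measurable_EFinP; apply: measurable_funM => //; exact: measurable_funX.
have [->|] := eqVneq (\int[mu]_y (box r (x, y) * a y ^+ 2)%:E)%E +oo%E.
  by rewrite gt0_muley ?leey// lte_fin.
rewrite -ltey => qfin.
have qi : mu.-integrable setT (EFin \o (fun y => box r (x, y) * a y ^+ 2)).
  by apply: ge0_integrable_EFin => //; exact/measurable_EFinP.
have bi := integrable_box r x ai.
have b1i : mu.-integrable setT (EFin \o (fun y => box r (x, y))).
  by apply: ge0_integrable_EFin => //; rewrite integral_box1// ltry.
rewrite -integrable_EFin_Rintegral// -EFinM lee_fin.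
set B := \int[mu]_y (box r (x, y) * a y); set Q := \int[mu]_y _.
pose m := B / (2 * r).
have bmi : mu.-integrable setT (EFin \o (fun y => 2 * m * (box r (x, y) * a y))).
  by apply: eq_integrable (integrableZl measurableT (2 * m) bi).
have b2i : mu.-integrable setT (EFin \o (fun y => - m ^+ 2 * box r (x, y))).
  by apply: eq_integrable (integrableZl measurableT (- m ^+ 2) b1i).
have : \int[mu]_y (2 * m * (box r (x, y) * a y) + - m ^+ 2 * box r (x, y)) <= Q.
  apply: le_Rintegral => //; first exact: integrable_add.
  move=> y _; have := mulr_ge0 (box_ge0 r (x, y)) (sqr_ge0 (a y - m)).
  by nra.
rewrite (RintegralD measurableT bmi b2i) !RintegralZl//.
rewrite [X in - m ^+ 2 * X](_ : _ = 2 * r); last by rewrite /Rintegral integral_box1.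
rewrite -(ler_pM2l r20); apply: le_trans.
rewrite le_eqVlt; apply/orP; left; apply/eqP; rewrite /m -/B.
by field; rewrite gt_eqF.
Qed.

(** The second factor 2 r comes from exchanging the integrals: each y lies in the window of a set of
    x of length 2 r. After normalisation, averaging contracts the L^2 norm. *)
Lemma integral_box_sqr_le a r : 0 < r -> mu.-integrable setT (EFin \o a) ->
  (\int[mu]_x ((\int[mu]_y (box r (x, y) * a y)) ^+ 2)%:E <=
   ((2 * r) ^+ 2)%:E * \int[mu]_y (a y ^+ 2)%:E)%E.
Proof.
move=> r0 ai; have ma := integrable_measurable ai.
have r20 : 0 < 2 * r by rewrite mulr_gt0.
pose q (z : RR * RR) : \bar R := (box r z * a z.2 ^+ 2)%:E.
have mq : measurable_fun setT q.
  apply/measurable_EFinP; apply: measurable_funM; first exact: measurable_box.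
  by apply: measurable_funX; exact: measurableT_comp.
have q0 z : (0 <= q z)%E by rewrite lee_fin mulr_ge0 ?box_ge0 ?sqr_ge0.
apply: (@le_trans _ _ (\int[mu]_x ((2 * r)%:E * \int[mu]_y q (x, y)))%E).
  apply: ge0_le_integral => //.
  - by move=> x _; rewrite lee_fin sqr_ge0.
  - apply/measurable_EFinP; apply: measurable_funX.
    apply: (@measurable_Rintegral_param _ _ _ _ _ mu (fun z : RR * RR => box r z * a z.2)).
    by apply: measurable_funM; [exact: measurable_box|exact: measurableT_comp].
  - apply: measurable_funeM; exact: (measurable_fun_fubini_tonelli_F q).
  - by move=> x _; exact: box_jensen.
rewrite ge0_integralZl_EFin//; [| |exact: (measurable_fun_fubini_tonelli_F q)|exact: ltW].
  rewrite (fubini_tonelli q)// expr2 (EFinM (2 * r)) -muleA lee_pmul2l//.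
  rewrite -ge0_integralZl_EFin//; [| | |exact: ltW].
  - rewrite le_eqVlt; apply/orP; left; apply/eqP; apply: eq_integral => y _.
    rewrite /q/=; under eq_integral do rewrite mulrC EFinM boxC.
    rewrite ge0_integralZl_EFin ?sqr_ge0//; last 2 first.
      by move=> x _; rewrite lee_fin box_ge0.
      exact/measurable_EFinP.
    by rewrite integral_box1// muleC.
  - by move=> y _; rewrite lee_fin sqr_ge0.
  - by apply/measurable_EFinP; exact: measurable_funX.
by move=> x _; exact: integral_ge0.
Qed.

End plancherel_real_line.

Section box_averages.
Context {R : realType}.
Local Notation mu := (@lebesgue_measure R).
Local Notation RR := (measurableTypeR R).
Implicit Types (a : R -> R) (r x : R).

Let rad (n : nat) : R := n.+1%:R^-1.
Let rad_gt0 n : 0 < rad n. Proof. by rewrite invr_gt0. Qed.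

Let avg a n x : R := (2 * rad n)^-1 * \int[mu]_y (box (rad n) (x, y) * a y).

(** Lebesgue differentiation along the balls of radius 1 / (n + 1), whose length is the normalising
    factor. *)
Lemma box_average_cvg a : mu.-integrable setT (EFin \o a) ->
  {ae mu, forall x, avg a n x @[n --> \oo] --> a x}.
Proof.
move=> ai.
have la : locally_integrable setT a.
  by apply: open_integrable_locally => //; exact: openT.
pose E (x : R) (n : nat) : set R := ball x (rad n).
have hE x : nicely_shrinking x (E x).
  split; first by move=> n; exact: measurable_ball.
  exists (1, fun n => PosNum (rad_gt0 n)); split => //=.
  - exact: cvg_harmonic.
  - by move=> n y.
  - by move=> n; rewrite mul1e.
apply: ae_imply (lebesgue_differentiation la) => x lx.
have := nice_lebesgue_differentiation hE la lx.
have EE n : ((mu (E x n))^-1 * \int[mu]_(y in E x n) (a y)%:E)%E = (avg a n x)%:E.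
  rewrite /E lebesgue_measure_ball ?ltW// inver mulrn_eq0/= gt_eqF//=.
  rewrite /avg [2 * _]mulr_natl EFinM; congr (_ * _)%E.
  rewrite integral_mkcond integrable_EFin_Rintegral; last exact: integrable_box.
  apply: eq_integral => y _; rewrite boxE patchE indicE.
  by case: ifP => _; rewrite ?mul1r ?mul0r.
by under eq_fun do rewrite EE; move=> /fine_cvgP[_].
Qed.

(** The box identity is divided by (2 r)^2. The normalised kernel is at most 1 everywhere and at
    least k as soon as |2 r xi| <= 1, while the averages contract the L^2 norm and converge to a.
    Fatou in frequency gives the constant c / k, Fatou in space gives 1 / c, and K is their sum. *)
Lemma real_plancherel : exists2 K : R, 0 < K & forall a,
  mu.-integrable setT (EFin \o a) ->
  (\int[mu]_xi (costransform a xi ^+ 2 + sintransform a xi ^+ 2)%:E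
     <= K%:E * \int[mu]_x (a x ^+ 2)%:E)%E /\
  (\int[mu]_x (a x ^+ 2)%:E <=
     K%:E * \int[mu]_xi (costransform a xi ^+ 2 + sintransform a xi ^+ 2)%:E)%E.
Proof.
have [c c0 Hc] := @integral_cosker R.
pose k : R := cos 2^-1 ^+ 2 / 2.
have k0 : 0 < k by rewrite divr_gt0// exprn_gt0// cos_half_gt0.
have ck0 : 0 < c / k + c^-1 by apply: addr_gt0; [exact: divr_gt0|rewrite invr_gt0].

exists (c / k + c^-1) => // a ai; have ma := integrable_measurable ai.
pose F xi : R := costransform a xi ^+ 2 + sintransform a xi ^+ 2.
have F0 xi : 0 <= F xi by rewrite addr_ge0// sqr_ge0.
have mF : measurable_fun setT F.
  by apply: measurable_funD; apply: measurable_funX;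
    [exact: measurable_costransform|exact: measurable_sintransform].
have mFE : measurable_fun setT (fun xi => (F xi)%:E) by exact/measurable_EFinP.
have ma2 : measurable_fun setT (fun x => (a x ^+ 2)%:E).
  by apply/measurable_EFinP; exact: measurable_funX.
have ia0 : (0 <= \int[mu]_x (a x ^+ 2)%:E)%E.
  by apply: integral_ge0 => x _; rewrite lee_fin sqr_ge0.
have iF0 : (0 <= \int[mu]_xi (F xi)%:E)%E.
  by apply: integral_ge0 => x _; rewrite lee_fin.
have h2 n : 0 < (2 * rad n) ^+ 2 by rewrite exprn_gt0// mulr_gt0.
pose G n xi : R := ((2 * rad n) ^+ 2)^-1 * (cosker (2 * rad n) xi * F xi).
have G0 n xi : 0 <= G n xi.
  by apply: mulr_ge0; [rewrite invr_ge0 ltW|rewrite mulr_ge0// cosker_ge0].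
have avg2 n x : avg a n x ^+ 2 =
    ((2 * rad n) ^+ 2)^-1 * (\int[mu]_y (box (rad n) (x, y) * a y)) ^+ 2.
  by rewrite /avg exprMn exprVn.
have GE n : (\int[mu]_xi (G n xi)%:E = c%:E * \int[mu]_x (avg a n x ^+ 2)%:E)%E.
  have [bi Fi E] := box_fourier_identity c0 Hc (rad_gt0 n) ai.
  rewrite /G; under eq_integral do rewrite EFinM.
  rewrite (integralZl measurableT Fi) -(integrable_EFin_Rintegral Fi) -[X in (_ * X%:E)%E]E.
  rewrite !EFinM (integrable_EFin_Rintegral bi) muleCA; congr (_ * _)%E.
  rewrite -(integralZl measurableT bi); apply: eq_integral => x _.
  by rewrite /= -EFinM avg2.
have avg_le n : (\int[mu]_x (avg a n x ^+ 2)%:E <= \int[mu]_x (a x ^+ 2)%:E)%E.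
  have [bi _ _] := box_fourier_identity c0 Hc (rad_gt0 n) ai.
  rewrite (_ : (\int[mu]_x (avg a n x ^+ 2)%:E)%E = (((2 * rad n) ^+ 2)^-1%:E *
      \int[mu]_x ((\int[mu]_y (box (rad n) (x, y) * a y)) ^+ 2)%:E)%E).
    by rewrite lee_pdivrMl//; exact: integral_box_sqr_le.
  rewrite -(integralZl measurableT bi); apply: eq_integral => x _.
  by rewrite /= -EFinM avg2.
have mG n : measurable_fun setT (fun xi => (G n xi)%:E).
  apply/measurable_EFinP; apply: measurable_funM => //; apply: measurable_funM => //.
  exact: measurable_cosker.
have mavg n : measurable_fun setT (avg a n).
  apply: measurable_funM => //.
  apply: (@measurable_Rintegral_param _ _ _ _ _ mu (fun z : RR * RR => box (rad n) z * a z.2)).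
  by apply: measurable_funM; [exact: measurable_box|exact: measurableT_comp].
split.
- have : (\int[mu]_xi (k%:E * (F xi)%:E) <= c%:E * \int[mu]_x (a x ^+ 2)%:E)%E.
    apply: (fatou_le (mu := mu) (f := fun n xi => (G n xi)%:E)) => //.
    + apply/measurable_EFinP; exact: measurable_funM.
    + by move=> xi; rewrite -EFinM lee_fin mulr_ge0// ltW.
    (* At xi = 0 the kernel vanishes by the convention on division, so the lower bound may fail at
       that point. *)
    + exists [set 0]; split => //; first exact: lebesgue_measure_set1.
      move=> xi /= H; apply: contrapT => xi0; apply: H.
      have {}xi0 : xi != 0 by apply/eqP.
      (* From this index on 2 |xi| < n + 1, so that |2 r xi| <= 1 with r = 1 / (n + 1). *)
      apply: (@limn_einf_ge _ _ _ (Num.truncn (2 * `|xi|))) => n nN.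
      rewrite -EFinM lee_fin /G mulrA ler_wpM2r// ler_pdivlMl//.
      rewrite /cosker ler_pdivlMr ?exprn_even_gt0//.
      rewrite (_ : _ * xi ^+ 2 = k * (2 * rad n * xi) ^+ 2); last by ring.
      apply: one_sub_cos_ge.
      rewrite !normrM (@ger0_norm _ 2)// (ger0_norm (ltW (rad_gt0 n))).
      rewrite mulrAC /rad ler_pdivrMr// mul1r.
      by rewrite ltW// (lt_le_trans (truncnS_gt _))// ler_nat ltnS.
    + by move=> n; rewrite GE lee_pmul2l.
  rewrite ge0_integralZl_EFin//; [|by move=> xi _; rewrite lee_fin|exact: ltW].
  rewrite -lee_pdivlMl// muleA -EFinM => /le_trans; apply.
  by rewrite lee_wpmul2r// lee_fin mulrC lerDl invr_ge0 ltW.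
- apply: (@le_trans _ _ (c^-1%:E * \int[mu]_xi (F xi)%:E)%E); last first.
    by rewrite lee_wpmul2r// lee_fin lerDr divr_ge0// ltW.
  apply: (fatou_le (mu := mu) (f := fun n x => (avg a n x ^+ 2)%:E)) => //.
  + move=> n; apply/measurable_EFinP.
    exact: (measurable_funX 2 (mavg n)).
  + by move=> n x; rewrite lee_fin sqr_ge0.
  + by move=> x; rewrite lee_fin sqr_ge0.
  + apply: ae_imply (box_average_cvg ai) => x ax.
    have : (avg a n x ^+ 2)%:E @[n --> \oo] --> (a x ^+ 2)%:E.
      by apply: cvg_EFin; [exact: nearW|]; exact: cvgM.
    by move=> /cvg_limn_einf_sup[-> _].
  + move=> n; rewrite lee_pdivlMl// -GE; apply: ge0_le_integral => //.
    * by move=> xi _; rewrite lee_fin.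
    * exact: mG.
    * move=> xi _; rewrite lee_fin /G mulrA; apply: ler_piMl => //.
      rewrite ler_pdivrMl// mulr1 (le_trans (cosker_le _ _))//.
      by rewrite ler_pdivrMr// ler_peMr ?sqr_ge0// ler1n.
Qed.

End box_averages.

Section plancherel_line.
Context {R : realType}.
Local Notation mu := (@lebesgue_measure R).
Local Notation RR := (measurableTypeR R).
Implicit Types a b : RR -> R.

Definition line_phase (x xi : RR) : R := x * xi.

Lemma measurable_line_phase :
  measurable_fun setT (fun z : RR * RR => line_phase z.1 z.2).
Proof. exact: measurable_funM. Qed.

Let fourier_reE a b : mu.-integrable setT (EFin \o a) ->
  mu.-integrable setT (EFin \o b) ->
  fourier_re mu line_phase a b = fun xi => costransform a xi + sintransform b xi.
Proof.
move=> ai bi; apply/funext => xi.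
have mx : measurable_fun setT (fun x : RR => x * xi) by exact: measurable_funM.
rewrite /fourier_re RintegralD//.
- apply: (integrable_bounded_mulr (M := 1)) => // [|x]; last exact: cos_max.
  exact: (measurableT_comp measurable_cos mx).
- apply: (integrable_bounded_mulr (M := 1)) => // [|x]; last exact: sin_max.
  exact: (measurableT_comp measurable_sin mx).
Qed.

Let costransformN a xi : costransform a (- xi) = costransform a xi.
Proof. by apply: eq_Rintegral => x _; rewrite mulrN cosN. Qed.

Let sintransformN a xi : mu.-integrable setT (EFin \o a) ->
  sintransform a (- xi) = - sintransform a xi.
Proof.
move=> ai; rewrite /sintransform -[RHS]mulN1r -RintegralZl//.
  by apply: eq_Rintegral => x _; rewrite mulrN sinN mulNr mulN1r.
have mx : measurable_fun setT (fun x : RR => x * xi) by exact: measurable_funM.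
apply: (integrable_bounded_mulr (M := 1)) => // [|x]; last exact: sin_max.
exact: (measurableT_comp measurable_sin mx).
Qed.

Let sintransform_opp a xi : mu.-integrable setT (EFin \o a) ->
  sintransform (\- a) xi = - sintransform a xi.
Proof.
move=> ai; rewrite -sintransformN//.
by apply: eq_Rintegral => x _; rewrite /= !mulrN sinN mulNr.
Qed.

(** The cross terms pair an even cosine transform with an odd sine transform, so they cancel between
    xi and - xi. As the integrals may be infinite, the cancellation is made inside the integrand, by
    averaging it with its reflection. *)
Let sqnorm_fourier a b : mu.-integrable setT (EFin \o a) ->
  mu.-integrable setT (EFin \o b) ->
  sqnorm mu (fourier_re mu line_phase a b) (fourier_re mu line_phase b (\- a)) =
  (\int[mu]_xi (costransform a xi ^+ 2 + sintransform a xi ^+ 2)%:E +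
   \int[mu]_xi (costransform b xi ^+ 2 + sintransform b xi ^+ 2)%:E)%E.
Proof.
move=> ai bi; have nai := integrable_opp ai.
have [ma mb] := (integrable_measurable ai, integrable_measurable bi).
have mFE (a' : RR -> R) : measurable_fun setT a' ->
    measurable_fun setT (fun xi : RR => (costransform a' xi ^+ 2 + sintransform a' xi ^+ 2)%:E).
  by move=> ma'; apply: measurable_sqsum;
    [exact: measurable_costransform|exact: measurable_sintransform].
rewrite -ge0_integralD//; [|exact: mFE|exact: mFE].
rewrite !fourier_reE// /sqnorm.
set P := fun xi : RR => ((costransform a xi + sintransform b xi) ^+ 2 +
  (costransform b xi + sintransform (\- a) xi) ^+ 2)%:E.
have mP : measurable_fun setT P.
  apply: measurable_sqsum; apply: measurable_funD.
  - exact: measurable_costransform.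
  - exact: measurable_sintransform.
  - exact: measurable_costransform.
  - exact: (measurable_sintransform (integrable_measurable nai)).
have P0 xi : (0 <= P xi)%E by rewrite lee_fin addr_ge0// sqr_ge0.
have h0 : 0 <= 2^-1 :> R by rewrite invr_ge0.
have mPN : measurable_fun setT (fun xi : RR => P (- xi)).
  by apply: (measurableT_comp mP); exact: oppr_measurable.
transitivity (\int[mu]_xi (2^-1%:E * (P xi + P (- xi)%R)))%E.
  rewrite ge0_integralZl_EFin//; last exact: emeasurable_funD.
  - rewrite ge0_integralD// ge0_integral_reflect//.
    have I0 : (0 <= \int[mu]_xi P xi)%E by exact: integral_ge0.
    rewrite ge0_muleDr// -ge0_muleDl ?lee_fin// -EFinD.
    by rewrite (_ : 2^-1 + 2^-1 = 1 :> R) ?mul1e//; field.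
  - by move=> xi _; exact: adde_ge0.
apply: eq_integral => xi _; rewrite /P -!EFinD -EFinM; congr EFin.
by rewrite !costransformN !sintransform_opp// !sintransformN//; field.
Qed.

Lemma plancherel_line : plancherel mu line_phase.
Proof.
have [K K0 HK] := @real_plancherel R; exists K => // a b ai bi.
rewrite sqnorm_fourier//.
have [a1 a2] := HK a ai; have [b1 b2] := HK b bi.
have ma2 (a' : RR -> R) : mu.-integrable setT (EFin \o a') ->
    measurable_fun setT (fun x : RR => (a' x ^+ 2)%:E).
  move=> /integrable_measurable ma'; apply/measurable_EFinP; exact: measurable_funX.
have sqr0 (a' : RR -> R) : (0 <= \int[mu]_x (a' x ^+ 2)%:E)%E.
  by apply: integral_ge0 => x _; rewrite lee_fin sqr_ge0.
have sqs0 (a' b' : RR -> R) : (0 <= \int[mu]_x (a' x ^+ 2 + b' x ^+ 2)%:E)%E.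
  by apply: integral_ge0 => x _; exact: sqsum_ge0.
rewrite (_ : sqnorm mu a b = (\int[mu]_x (a x ^+ 2)%:E + \int[mu]_x (b x ^+ 2)%:E)%E); last first.
  have s0 (a' : RR -> R) x : [set: RR] x -> (0 <= (a' x ^+ 2)%:E)%E.
    by rewrite lee_fin sqr_ge0.
  by rewrite -(ge0_integralD mu measurableT (s0 a) (ma2 a ai) (s0 b) (ma2 b bi)).
by split; rewrite ge0_muleDr//; apply: leeD.
Qed.

End plancherel_line.

(** * Plancherel inequalities on R^n *)

Section lebesgue_Rn_sigma_finite.
Context {R : realType}.

Lemma leb_sigma_finite n : sigma_finite setT (@leb R n).
Proof.
pose A k : set (measurableTypeR R) := `](- k.+1%:R), (k.+1%:R)[%classic.
exists (fun k => [set x : Rn R n | forall i, A k (tnth x i)]).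
  apply/esym; rewrite -subTset => x _.
  exists (\max_(i < n) Num.truncn `|tnth x i|)%N => //= i.
  rewrite /A /= in_itv/= -ltr_norml (lt_le_trans (truncnS_gt _))// ler_nat ltnS.
  exact: (@leq_bigmax _ (fun i : 'I_n => Num.truncn `|tnth x i|) i).
move=> k; split; last first.
  rewrite (@leb_box R n (fun=> A k)); last by move=> i; exact: measurable_itv.
  under eq_bigr do rewrite /A lebesgue_measure_itv/= lte_fin gtrN//.
  by rewrite -EFinB prodEFin ltry.
rewrite (_ : [set _ | _] = \bigcap_(i in [set: 'I_n]) ((fun x => tnth x i) @^-1` A k)).
  apply: fin_bigcap_measurable => // i _.
  by rewrite -[_ @^-1` _]setTI; apply: measurable_tnth => //; exact: measurable_itv.
by apply/seteqP; split => [x H i _|x H i]; exact: H.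
Qed.

(** An alias of [leb n] to carry the sigma-finite structure on which the Fubini lemmas rely. *)
Definition lebfun n : set (Rn R n) -> \bar R := @leb R n.
HB.instance Definition _ n := Measure.copy (@lebfun n) (@leb R n).
HB.instance Definition _ n := Measure_isSigmaFinite.Build _ _ _ (@lebfun n) (@leb_sigma_finite n).

Lemma lebfunE n : (@lebfun n : {measure set (Rn R n) -> \bar R}) = @leb R n.
Proof. exact: eq_measure. Qed.

End lebesgue_Rn_sigma_finite.

Section plancherel_Rn.
Context {R : realType}.

Lemma measurable_dotp n :
  measurable_fun setT (fun z : Rn R n * Rn R n => dotp z.1 z.2).
Proof.
apply: measurable_sum => i; apply: measurable_funM.
- by apply: (measurableT_comp (measurable_tnth i)); exact: measurable_fst.
- by apply: (measurableT_comp (measurable_tnth i)); exact: measurable_snd.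
Qed.

Lemma dotp_cons n (p q : Rn R n * measurableTypeR R) :
  dotp (cons_Rn p) (cons_Rn q) = prod_phase (@dotp R n) line_phase p q.
Proof.
rewrite /dotp big_ord_recl addrC /prod_phase /line_phase; congr (_ + _).
by apply: eq_bigr => i _; rewrite !tnthS.
Qed.

Lemma measurable_fourier_re_Rn n (a b : Rn R n -> R) :
  measurable_fun setT a -> measurable_fun setT b ->
  measurable_fun setT (fourier_re (@leb R n) (@dotp R n) a b).
Proof.
by move=> ma mb; rewrite -lebfunE; apply: measurable_fourier_re => //; exact: measurable_dotp.
Qed.

Lemma ge0_integral_leb_succ n (f : Rn R n.+1 -> \bar R) :
  measurable_fun setT f -> (forall x, 0 <= f x)%E ->
  (\int[@leb R n.+1]_x f x =
   \int[(@lebfun R n \x lebesgue_measure)%E]_p f (cons_Rn p))%E.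
Proof.
move=> mf f0.
have -> : (\int[(@lebfun R n \x lebesgue_measure)%E]_p f (cons_Rn p) =
    \int[(@leb R n \x lebesgue_measure)%E]_p f (cons_Rn p))%E.
  exact: eq_measure_integral.
exact: (ge0_integral_pushforward (@measurable_cons_Rn R n) _ measurableT mf (fun x _ => f0 x)).
Qed.

Lemma integrable_leb_succ n (f : Rn R n.+1 -> R) :
  (@leb R n.+1).-integrable setT (EFin \o f) ->
  (@lebfun R n \x lebesgue_measure)%E.-integrable setT (EFin \o (f \o @cons_Rn R n)).
Proof.
move=> /integrableP[mf fi]; apply/integrableP; split.
  exact: (measurableT_comp mf (@measurable_cons_Rn R n)).
by rewrite -(ge0_integral_leb_succ (f := fun x => `|(f x)%:E|%E))//; exact: measurableT_comp.
Qed.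

Lemma Rintegral_leb_succ n (f : Rn R n.+1 -> R) :
  (@leb R n.+1).-integrable setT (EFin \o f) ->
  \int[@leb R n.+1]_x f x = \int[(@lebfun R n \x lebesgue_measure)%E]_p f (cons_Rn p).
Proof.
move=> fi; have mf := measurable_int _ fi.
rewrite /Rintegral; congr fine.
have -> : (\int[(@lebfun R n \x lebesgue_measure)%E]_p (f (cons_Rn p))%:E =
    \int[(@leb R n \x lebesgue_measure)%E]_p (f (cons_Rn p))%:E)%E.
  exact: eq_measure_integral.
apply: (@integral_pushforward _ _ _ _ _ _ (@measurable_cons_Rn R n) _ setT (EFin \o f)) => //.
exact: integrable_leb_succ.
Qed.

(** On a single point of mass 1 the phase is 0 and the transform is the identity. *)
Lemma plancherel_leb0 : plancherel (@leb R 0) (@dotp R 0).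
Proof.
have one (x : Rn R 0) : x = [tuple] by exact: tuple0.
have mea (f : Rn R 0 -> \bar R) : measurable_fun setT f.
  by rewrite (_ : f = cst (f [tuple])) //; apply/funext => x; rewrite (one x).
have F (a b : Rn R 0 -> R) : fourier_re (@leb R 0) (@dotp R 0) a b = a.
  apply/funext => xi; rewrite /fourier_re /Rintegral integral_dirac// diracT mul1e/=.
  by rewrite /dotp big_ord0 cos0 sin0 mul1r mul0r addr0 (one xi).
have S (a b : Rn R 0 -> R) : sqnorm (@leb R 0) a b = (a [tuple] ^+ 2 + b [tuple] ^+ 2)%:E.
  by rewrite /sqnorm integral_dirac// diracT mul1e.
by exists 1 => // a b _ _; rewrite !F !S mul1e.
Qed.

Lemma plancherel_leb n : plancherel (@leb R n) (@dotp R n).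
Proof.
elim: n => [|n IH]; first exact: plancherel_leb0.
rewrite -lebfunE in IH.
have [K K0 HK] := plancherel_prod (@measurable_dotp n) measurable_line_phase IH plancherel_line.
exists K => // a b ai bi.
have [ma mb] := (integrable_measurable ai, integrable_measurable bi).
have nai := integrable_opp ai.
have sqE (u v : Rn R n.+1 -> R) : measurable_fun setT u -> measurable_fun setT v ->
    sqnorm (@leb R n.+1) u v =
    sqnorm (@lebfun R n \x lebesgue_measure)%E (u \o @cons_Rn R n) (v \o @cons_Rn R n).
  by move=> mu mv; exact: (ge0_integral_leb_succ (measurable_sqsum mu mv) (sqsum_ge0 u v)).
have FE (u v : Rn R n.+1 -> R) :
    (@leb R n.+1).-integrable setT (EFin \o u) ->
    (@leb R n.+1).-integrable setT (EFin \o v) ->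
    fourier_re (@leb R n.+1) (@dotp R n.+1) u v \o @cons_Rn R n =
    fourier_re (@lebfun R n \x lebesgue_measure)%E (prod_phase (@dotp R n) line_phase)
      (u \o @cons_Rn R n) (v \o @cons_Rn R n).
  move=> ui vi; apply/funext => q /=; rewrite /fourier_re Rintegral_leb_succ.
    by apply: eq_Rintegral => p _; rewrite dotp_cons.
  apply: integrable_fourier_re => //; exact: measurable_dotp.
rewrite (sqE a b)// (sqE (fourier_re _ _ _ _)); first last.
- by apply: measurable_fourier_re_Rn => //; exact: integrable_measurable nai.
- exact: measurable_fourier_re_Rn.
rewrite (FE a b)// (FE b (\- a))//.
by apply: HK; exact: integrable_leb_succ.
Qed.

End plancherel_Rn.

(** * The Fourier transform in L^2 *)

Section complex_square.
Context {R : realType}.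
Implicit Types z w : R[i].
Local Open Scope complex_scope.

Definition nsq z : R := complex.Re z ^+ 2 + complex.Im z ^+ 2.

Lemma normc_sqr z : normc z ^+ 2 = nsq z.
Proof. by case: z => a b; rewrite /normc /nsq/= sqr_sqrtr ?addr_ge0 ?sqr_ge0. Qed.

Lemma nsq_ge0 z : 0 <= nsq z.
Proof. by rewrite addr_ge0 ?sqr_ge0. Qed.

Lemma ReB z w : complex.Re (z - w) = complex.Re z - complex.Re w.
Proof. by case: z w => [a b] [c d]. Qed.

Lemma ImB z w : complex.Im (z - w) = complex.Im z - complex.Im w.
Proof. by case: z w => [a b] [c d]. Qed.

Lemma nsqB_le z w : nsq (z - w) <= 2 * nsq z + 2 * nsq w.
Proof.
rewrite /nsq ReB ImB.
have := sqr_ge0 (complex.Re z + complex.Re w); have := sqr_ge0 (complex.Im z + complex.Im w).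
by nra.
Qed.

Lemma nsqN z : nsq (- z) = nsq z.
Proof. by case: z => a b; rewrite /nsq/= !sqrrN. Qed.

Lemma nsqBC z w : nsq (z - w) = nsq (w - z).
Proof. by rewrite /nsq !ReB !ImB; ring. Qed.

Lemma nsqM z w : nsq (z * w) = nsq z * nsq w.
Proof. by case: z w => [a b] [c d]; rewrite /nsq/=; ring. Qed.

Lemma nsqC (r : R) : nsq r%:C = r ^+ 2.
Proof. by rewrite /nsq/= expr0n addr0. Qed.

Lemma nsq_eq0 z : nsq z = 0 -> z = 0.
Proof.
case: z => a b /eqP; rewrite /nsq/= paddr_eq0 ?sqr_ge0// !sqrf_eq0.
by move=> /andP[/eqP-> /eqP->].
Qed.

Lemma normc_ge0 z : 0 <= normc z.
Proof. by case: z => a b; rewrite sqrtr_ge0. Qed.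

Lemma normr_Re_le z : `|complex.Re z| <= normc z.
Proof.
rewrite -(@ler_pXn2r _ 2) ?nnegrE ?normc_ge0// normc_sqr real_normK ?num_real//.
by rewrite lerDl sqr_ge0.
Qed.

Lemma normr_Im_le z : `|complex.Im z| <= normc z.
Proof.
rewrite -(@ler_pXn2r _ 2) ?nnegrE ?normc_ge0// normc_sqr real_normK ?num_real//.
by rewrite lerDr sqr_ge0.
Qed.

End complex_square.

Section energy_integral.
Context {R : realType} {n : nat}.
Implicit Types f g : Rn R n -> R[i].
Local Open Scope complex_scope.

Definition E2 f : \bar R := (\int[@leb R n]_x (nsq (f x))%:E)%E.

Lemma E2_ge0 f : (0 <= E2 f)%E.
Proof. by apply: integral_ge0 => x _; rewrite lee_fin nsq_ge0. Qed.

Lemma measurable_nsq f : cmeasurable f -> measurable_fun setT (fun x => (nsq (f x))%:E).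
Proof. by move=> [mr mi]; exact: measurable_sqsum. Qed.

Lemma cmeasurableB f g : cmeasurable f -> cmeasurable g ->
  cmeasurable (fun x => f x - g x).
Proof.
move=> [fr fi] [gr gi]; split.
- by under eq_fun do rewrite ReB; exact: measurable_funB.
- by under eq_fun do rewrite ImB; exact: measurable_funB.
Qed.

Lemma E2B_le f g : cmeasurable f -> cmeasurable g ->
  (E2 (fun x => (f x - g x)%R) <= 2%:E * E2 f + 2%:E * E2 g)%E.
Proof.
move=> mf mg; have [nf ng] := (measurable_nsq mf, measurable_nsq mg).
rewrite /E2 -!ge0_integralZl_EFin//; [|by move=> x _; rewrite lee_fin nsq_ge0|
  by move=> x _; rewrite lee_fin nsq_ge0].
rewrite -ge0_integralD//; [|by move=> x _; rewrite -EFinM lee_fin mulr_ge0 ?nsq_ge0|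
  exact: measurable_funeM|by move=> x _; rewrite -EFinM lee_fin mulr_ge0 ?nsq_ge0|
  exact: measurable_funeM].
apply: ge0_le_integral => //.
- by move=> x _; rewrite lee_fin nsq_ge0.
- by apply: measurable_nsq; exact: cmeasurableB.
- by apply: emeasurable_funD; exact: measurable_funeM.
- by move=> x _; rewrite -!EFinM -EFinD lee_fin nsqB_le.
Qed.

Lemma E2_le_sub f g : cmeasurable f -> cmeasurable g ->
  (E2 f <= 2%:E * E2 (fun x => (f x - g x)%R) + 2%:E * E2 g)%E.
Proof.
move=> mf mg; have mng : cmeasurable (fun x => - g x).
  have [gr gi] := mg; split.
  - by under eq_fun do rewrite -sub0r ReB/=; exact: measurable_funB.
  - by under eq_fun do rewrite -sub0r ImB/=; exact: measurable_funB.
have := E2B_le (cmeasurableB mf mg) mng.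
rewrite (_ : E2 (fun x => - g x) = E2 g); last first.
  by apply: eq_integral => x _; rewrite nsqN.
by congr (_ <= _)%E; apply: eq_integral => x _; rewrite opprK subrK.
Qed.

Lemma E2BC f g : E2 (fun x => f x - g x) = E2 (fun x => g x - f x).
Proof. by apply: eq_integral => x _; rewrite nsqBC. Qed.

Lemma enormL2_powR f : (enormL 2%:E f `^ 2 = E2 f)%E.
Proof.
rewrite /enormL poweR_Lnorm//; apply: eq_integral => x _.
by rewrite poweR_EFin ger0_norm ?normc_ge0// powR_mulrn ?normc_ge0// normc_sqr.
Qed.

Lemma enormL2_lty f : (enormL 2%:E f < +oo)%E <-> (E2 f < +oo)%E.
Proof.
rewrite -enormL2_powR; have := Lnorm_ge0 (@leb R n) 2%:E (fun x => (normc (f x))%:E).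
rewrite -/(enormL _ _); case: (enormL _ _) => [r| |]//.
- by rewrite poweR_EFin !ltry.
- by rewrite poweRyr.
Qed.

Lemma normL2_sqr_le f : ((normL 2%:E f ^+ 2)%:E <= E2 f)%E.
Proof.
rewrite -enormL2_powR /normL.
have := Lnorm_ge0 (@leb R n) 2%:E (fun x => (normc (f x))%:E).
rewrite -/(enormL _ _); case: (enormL _ _) => [r| |]//.
- by rewrite lee_fin => r0; rewrite poweR_EFin lee_fin powR_mulrn.
- by move=> _; rewrite poweRyr// leey.
Qed.

Lemma normL2_sqrE f : (E2 f < +oo)%E -> (E2 f = (normL 2%:E f ^+ 2)%:E)%E.
Proof.
rewrite -enormL2_powR /normL.
have := Lnorm_ge0 (@leb R n) 2%:E (fun x => (normc (f x))%:E).
rewrite -/(enormL _ _); case: (enormL _ _) => [r| |]//.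
- by rewrite lee_fin => r0 _; rewrite poweR_EFin powR_mulrn.
- by rewrite poweRyr.
Qed.

Lemma enormL1E f : (enormL 1%:E f = \int[@leb R n]_x (normc (f x))%:E)%E.
Proof.
rewrite /enormL Lnorm1; apply: eq_integral => x _.
by rewrite /= ger0_norm ?normc_ge0.
Qed.

Lemma cvg_enormL2_near T (F : set_system T) (FF : Filter F) (h : T -> Rn R n -> R[i]) :
  enormL 2%:E (h t) @[t --> F] --> 0%E ->
  forall eps : R, 0 < eps -> \forall t \near F, (E2 (h t) <= eps%:E)%E.
Proof.
(* A norm below 1 dominates its own square, so the minimum with 1 transfers the bound to the squared
   norm. *)
move=> h0 eps eps0; pose d := Num.min eps 1.
have d0 : 0 < d by rewrite lt_min eps0 ltr01.
have : \forall t \near F, (enormL 2%:E (h t) < d%:E)%E.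
  by apply: (h0 [set x | (x < d%:E)%E]); apply: open_ereal_lt'; rewrite lte_fin.
apply: filterS => t; rewrite -enormL2_powR.
have := Lnorm_ge0 (@leb R n) 2%:E (fun x => (normc (h t x))%:E).
rewrite -/(enormL _ _); case: (enormL _ _) => [r| |]//.
rewrite lee_fin lte_fin => r0 rd; rewrite poweR_EFin lee_fin powR_mulrn//.
have [rl1 re] : r < 1 /\ r < eps by move: rd; rewrite lt_min => /andP[].
by rewrite expr2 (le_trans _ (ltW re))// ler_piMl// ltW.
Qed.

End energy_integral.

Section fourier_theory.
Context {R : realType} {n : nat}.
Implicit Types f g : Rn R n -> R[i].
Local Open Scope complex_scope.

Lemma inL2P f : inL 2%:E f <-> cmeasurable f /\ (E2 f < +oo)%E.
Proof. by split=> -[mf /enormL2_lty fi]; split. Qed.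

Lemma inL2B f g : inL 2%:E f -> inL 2%:E g -> inL 2%:E (fun x => f x - g x).
Proof.
move=> /inL2P[mf fi] /inL2P[mg gi]; apply/inL2P; split; first exact: cmeasurableB.
by apply: le_lt_trans (E2B_le mf mg) _; rewrite lte_add_pinfty// lte_mul_pinfty.
Qed.

Lemma measurable_normc f : cmeasurable f ->
  measurable_fun setT (fun x => (normc (f x))%:E).
Proof.
move=> mf; apply/measurable_EFinP.
rewrite (_ : (fun x => _) = fun x => Num.sqrt (nsq (f x))).
  have ms : measurable_fun setT (@Num.sqrt R).
    by apply: continuous_measurable_fun; exact: sqrt_continuous.
  apply: (measurableT_comp ms); apply/measurable_EFinP; exact: measurable_nsq.
by apply/funext => x; rewrite -normc_sqr sqrtr_sqr ger0_norm ?normc_ge0.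
Qed.

Lemma inL1B f g : inL 1%:E f -> inL 1%:E g -> inL 1%:E (fun x => f x - g x).
Proof.
move=> [mf fi] [mg gi]; split; first exact: cmeasurableB.
rewrite enormL1E; rewrite enormL1E in fi; rewrite enormL1E in gi.
apply: (@le_lt_trans _ _ (\int[@leb R n]_x ((normc (f x))%:E + (normc (g x))%:E))%E).
  apply: ge0_le_integral => //.
  - by move=> x _; rewrite lee_fin normc_ge0.
  - by apply: measurable_normc; exact: cmeasurableB.
  - by apply: emeasurable_funD; exact: measurable_normc.
  - move=> x _; rewrite -EFinD lee_fin -(normcN (g x)).
    exact: le_normcD.
rewrite ge0_integralD//; [exact: lte_add_pinfty| | | |].
- by move=> x _; rewrite lee_fin normc_ge0.
- exact: measurable_normc.
- by move=> x _; rewrite lee_fin normc_ge0.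
- exact: measurable_normc.
Qed.

Lemma inL1_integrable f : inL 1%:E f ->
  (@leb R n).-integrable setT (EFin \o (fun x => complex.Re (f x))) /\
  (@leb R n).-integrable setT (EFin \o (fun x => complex.Im (f x))).
Proof.
move=> [mf fi]; have [mr mi] := mf; rewrite enormL1E in fi.
have ni : (@leb R n).-integrable setT (EFin \o (fun x => normc (f x))).
  apply: ge0_integrable_EFin => //; first by move=> x; exact: normc_ge0.
  by apply/measurable_EFinP; exact: measurable_normc.
split; apply: le_integrable ni => //.
- exact/measurable_EFinP.
- by move=> x _ /=; rewrite lee_fin (ger0_norm (normc_ge0 _)) normr_Re_le.
- exact/measurable_EFinP.
- by move=> x _ /=; rewrite lee_fin (ger0_norm (normc_ge0 _)) normr_Im_le.
Qed.

Lemma fourier1E f xi : fourier1 f xi =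
  fourier_re (@leb R n) (@dotp R n) (fun x => complex.Re (f x)) (fun x => complex.Im (f x)) xi
  +i* fourier_re (@leb R n) (@dotp R n)
    (fun x => complex.Im (f x)) (\- (fun x => complex.Re (f x))) xi.
Proof.
rewrite /fourier1 /cintegral /fourier_re; congr (_ +i* _);
by apply: eq_Rintegral => x _ /=; case: (f x) => a b /=; ring.
Qed.

Lemma cmeasurable_fourier1 f : inL 1%:E f -> cmeasurable (fourier1 f).
Proof.
move=> f1; have [ri ii] := inL1_integrable f1; have nri := integrable_opp ri.
split; under eq_fun do rewrite fourier1E/=; apply: measurable_fourier_re_Rn;
by [exact: integrable_measurable ri|exact: integrable_measurable ii|
  exact: integrable_measurable nri].
Qed.

Lemma plancherel_E2 : exists2 K : R, 0 < K & forall f, inL 1%:E f ->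
  (E2 (fourier1 f) <= K%:E * E2 f)%E /\ (E2 f <= K%:E * E2 (fourier1 f))%E.
Proof.
have [K K0 HK] := @plancherel_leb R n; exists K => // f /inL1_integrable[ri ii].
have [h1 h2] := HK _ _ ri ii.
have E : E2 (fourier1 f) = sqnorm (@leb R n)
  (fourier_re (@leb R n) (@dotp R n) (fun x => complex.Re (f x)) (fun x => complex.Im (f x)))
  (fourier_re (@leb R n) (@dotp R n)
    (fun x => complex.Im (f x)) (\- (fun x => complex.Re (f x)))).
  by apply: eq_integral => xi _; rewrite fourier1E.
by rewrite E; split; [exact: h1|exact: h2].
Qed.

Lemma fourier1B f g xi : inL 1%:E f -> inL 1%:E g ->
  fourier1 (fun x => f x - g x) xi = fourier1 f xi - fourier1 g xi.
Proof.
move=> /inL1_integrable[fr fi] /inL1_integrable[gr gi].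
have fourier_reB (a b c d : Rn R n -> R) : (@leb R n).-integrable setT (EFin \o a) ->
    (@leb R n).-integrable setT (EFin \o b) -> (@leb R n).-integrable setT (EFin \o c) ->
    (@leb R n).-integrable setT (EFin \o d) ->
    fourier_re (@leb R n) (@dotp R n) (fun x => a x - c x) (fun x => b x - d x) xi =
    fourier_re (@leb R n) (@dotp R n) a b xi - fourier_re (@leb R n) (@dotp R n) c d xi.
  move=> ai bi ci di; rewrite /fourier_re.
  have i1 := integrable_fourier_re (@measurable_dotp R n) xi ai bi.
  have i2 := integrable_fourier_re (@measurable_dotp R n) xi ci di.
  by rewrite -(RintegralB measurableT i1 i2); apply: eq_Rintegral => x _ /=; ring.
rewrite !fourier1E; apply/eqP; rewrite eq_complex/=; apply/andP; split; apply/eqP.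
- rewrite -fourier_reB//; apply: eq_Rintegral => x _.
  by rewrite ReB ImB.
- have nfr := integrable_opp fr; have ngr := integrable_opp gr.
  rewrite -(fourier_reB _ _ _ _ fi nfr gi ngr); apply: eq_Rintegral => x _ /=.
  by rewrite ReB ImB; ring.
Qed.

Lemma is_fourier_le : exists2 K : R, 0 < K & forall f g, is_fourier f g ->
  (E2 g <= K%:E * E2 f)%E /\ (E2 f <= K%:E * E2 g)%E.
Proof.
have [K K0 HK] := plancherel_E2; exists (4 * K); first by rewrite mulr_gt0.
move=> f g [/inL2P[mf f2] /inL2P[mg g2] [fk [fk12 fkf fkg]]].
have approx eps : 0 < eps -> exists h, [/\ inL 1%:E h, inL 2%:E h,
    (E2 (fun x => (h x - f x)%R) <= eps%:E)%E &
    (E2 (fun x => (fourier1 h x - g x)%R) <= eps%:E)%E].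
  move=> e0; have [k [? ?]] : exists k, (E2 (fun x => (fk k x - f x)%R) <= eps%:E)%E /\
    (E2 (fun x => (fourier1 (fk k) x - g x)%R) <= eps%:E)%E.
    near \oo => k; exists k; split; near: k;
      [exact: (cvg_enormL2_near _ fkf)|exact: (cvg_enormL2_near _ fkg)].
  by exists (fk k); have [? ?] := fk12 k; split.
have fin h : (E2 h < +oo)%E -> exists r : R, E2 h = r%:E.
  by have := E2_ge0 h; case: (E2 h) => // r _ _; exists r.
(* Written for generic functions so as to serve both directions, with w the function bounding u and
   primes marking approximations. Each approximation costs a factor 2, whence 4 K, and the errors
   vanish with eps. *)
have chain (u u' w w' : Rn R n -> R[i]) eps : 0 < eps ->
    cmeasurable u -> cmeasurable u' -> cmeasurable w -> cmeasurable w' ->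
    (E2 (fun x => (u' x - u x)%R) <= eps%:E)%E ->
    (E2 (fun x => (w' x - w x)%R) <= eps%:E)%E ->
    (E2 u' <= K%:E * E2 w')%E -> (E2 w < +oo)%E ->
    (E2 u <= (4 * K)%:E * E2 w + ((2 + 4 * K) * eps)%:E)%E.
  move=> e0 mu mu' mw mw' hu hw h /fin[r Er]; rewrite E2BC in hu.
  apply: (le_trans (E2_le_sub mu mu')).
  apply: (@le_trans _ _ (2%:E * eps%:E + 2%:E * (K%:E * (2%:E * eps%:E + 2%:E * E2 w)))%E).
    apply: leeD; rewrite lee_pmul2l//.
    apply: (le_trans h); rewrite lee_pmul2l//.
    apply: (le_trans (E2_le_sub mw' mw)).
    by apply: leeD => //; rewrite lee_pmul2l.
  by rewrite Er -!(EFinM, EFinD) lee_fin; lra.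
have scale e : 0 < e -> exists2 d, 0 < d & e = (2 + 4 * K) * d.
  have K2 : 0 < 2 + 4 * K by rewrite addr_gt0// mulr_gt0.
  move=> e0; exists (e / (2 + 4 * K)); first exact: divr_gt0.
  by rewrite mulrC divfK// gt_eqF.
split; apply/lee_addgt0Pr => e /scale[d d0 ->].
- have [h [h1 [mh _] hf hg]] := approx d d0.
  by apply: (chain g (fourier1 h) f h) => //; [exact: cmeasurable_fourier1|exact: (HK h h1).1].
- have [h [h1 [mh _] hf hg]] := approx d d0.
  by apply: (chain f h g (fourier1 h)) => //; [exact: cmeasurable_fourier1|exact: (HK h h1).2].
Unshelve. all: by end_near. Qed.

End fourier_theory.

Section L2_transform.
Context {R : realType} {n : nat}.
Implicit Types f g : Rn R n -> R[i].
Local Open Scope complex_scope.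

Lemma near_cvg_enormL2 T (F : set_system T) (FF : Filter F) (h : T -> Rn R n -> R[i]) :
  (forall eps : R, 0 < eps -> \forall t \near F, (E2 (h t) <= eps%:E)%E) ->
  enormL 2%:E (h t) @[t --> F] --> 0%E.
Proof.
move=> H.
have small eps : 0 < eps -> \forall t \near F, exists2 r : R, 0 <= r <= eps &
    enormL 2%:E (h t) = r%:E.
  move=> e0; have := H (eps ^+ 2) (exprn_gt0 _ e0); apply: filterS => t.
  rewrite -enormL2_powR.
  have := Lnorm_ge0 (@leb R n) 2%:E (fun x => (normc (h t x))%:E).
  rewrite -/(enormL _ _); case: (enormL _ _) => [r| |]//.
  - rewrite lee_fin => r0; rewrite poweR_EFin lee_fin powR_mulrn// => re.
    by exists r => //; rewrite r0 -(@ler_pXn2r _ 2) ?nnegrE// ltW.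
  - by rewrite poweRyr.
apply/fine_cvgP; split.
  by apply: filterS (small 1 ltr01) => t [r _ ->].
apply/cvgrPdist_le => eps e0; apply: filterS (small eps e0) => t [r /andP[r0 re] /= ->].
by rewrite sub0r normrN ger0_norm.
Qed.

Lemma cvg_enormL2B T (F : set_system T) (FF : Filter F) (h1 h2 : T -> Rn R n -> R[i]) f1 f2 :
  (forall t, cmeasurable (h1 t)) -> (forall t, cmeasurable (h2 t)) ->
  cmeasurable f1 -> cmeasurable f2 ->
  enormL 2%:E (fun x => h1 t x - f1 x) @[t --> F] --> 0%E ->
  enormL 2%:E (fun x => h2 t x - f2 x) @[t --> F] --> 0%E ->
  enormL 2%:E (fun x => (h1 t x - h2 t x) - (f1 x - f2 x)) @[t --> F] --> 0%E.
Proof.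
move=> mh1 mh2 mf1 mf2 c1 c2; apply: near_cvg_enormL2 => eps e0.
have e4 : 0 < eps / 4 by rewrite divr_gt0.
have n1 := cvg_enormL2_near FF c1 e4; have n2 := cvg_enormL2_near FF c2 e4.
apply: filterS2 n1 n2 => t n1 n2.
rewrite (_ : E2 _ = E2 (fun x => (h1 t x - f1 x) - (h2 t x - f2 x))); last first.
  by apply: eq_integral => x _; congr (nsq _)%:E; ring.
apply: (le_trans (E2B_le (cmeasurableB (mh1 t) mf1) (cmeasurableB (mh2 t) mf2))).
apply: (@le_trans _ _ (2%:E * (eps / 4)%:E + 2%:E * (eps / 4)%:E)%E).
  by apply: leeD; rewrite lee_pmul2l.
by rewrite -!EFinM -EFinD lee_fin; lra.
Qed.

Lemma is_fourierB f1 g1 f2 g2 : is_fourier f1 g1 -> is_fourier f2 g2 ->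
  is_fourier (fun x => f1 x - f2 x) (fun xi => g1 xi - g2 xi).
Proof.
move=> [f1L g1L [h1 [h1L h1f h1g]]] [f2L g2L [h2 [h2L h2f h2g]]].
split; [exact: inL2B|exact: inL2B|exists (fun k x => h1 k x - h2 k x); split].
- move=> k; have [a1 a2] := h1L k; have [b1 b2] := h2L k.
  by split; [exact: inL1B|exact: inL2B].
- apply: cvg_enormL2B => //.
  + by move=> k; have [_ []] := h1L k.
  + by move=> k; have [_ []] := h2L k.
  + by case: f1L.
  + by case: f2L.
- under eq_fun => k.
    under eq_fun => xi do rewrite (fourier1B xi (h1L k).1 (h2L k).1).
    over.
  apply: (@cvg_enormL2B _ _ _ (fun k => fourier1 (h1 k)) (fun k => fourier1 (h2 k))) => //.
  + by move=> k; apply: cmeasurable_fourier1; have [] := h1L k.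
  + by move=> k; apply: cmeasurable_fourier1; have [] := h2L k.
  + by case: g1L.
  + by case: g2L.
Qed.

(** The difference g - g' is a transform of f - f = 0, so its L^2 norm vanishes, whatever the two
    approximating sequences are. *)
Lemma is_fourier_unique f g g' : is_fourier f g -> is_fourier f g' ->
  {ae @leb R n, forall xi, g xi = g' xi}.
Proof.
move=> fg fg'; have [K K0 HK] := @is_fourier_le R n.
have FB := is_fourierB fg fg'; have [+ _] := HK _ _ FB.
have [_ [mg _] _] := FB.
rewrite (_ : E2 (fun x => f x - f x) = 0%E); last first.
  by apply: integral0_eq => x _; rewrite subrr /nsq/= expr0n addr0.
rewrite mule0 => E0.
have {}E0 : (\int[@leb R n]_xi `|(nsq (g xi - g' xi))%:E| = 0)%E.
  apply/eqP; rewrite eq_le integral_ge0// andbT (le_trans _ E0)//.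
  by rewrite le_eqVlt; apply/orP; left; apply/eqP; apply: eq_integral => xi _;
    rewrite gee0_abs// lee_fin nsq_ge0.
have := (ae_eq_integral_abs _ measurableT (measurable_nsq mg)).1 E0.
apply: filterS => xi /(_ I) [] /nsq_eq0 /eqP; rewrite subr_eq0 => /eqP.
exact.
Qed.

Lemma is_fourier_fourier1 f : inL 1%:E f -> inL 2%:E f -> is_fourier f (fourier1 f).
Proof.
move=> f1 f2; have [K K0 HK] := @plancherel_E2 R n; have [KA _] := HK f f1.
have z (g : Rn R n -> R[i]) : enormL 2%:E (fun x => g x - g x) = 0%E.
  rewrite (_ : (fun x => g x - g x) = fun=> 0); last by apply/funext => x; rewrite subrr.
  rewrite /enormL (eq_Lnorm _ _ (g := cst 0%E)) ?Lnorm0//.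
  by move=> x /=; rewrite expr0n/= addr0 sqrtr0.
split => //.
- apply/inL2P; split; first exact: cmeasurable_fourier1.
  by apply: le_lt_trans KA _; move/inL2P: f2 => [_ f2]; rewrite lte_mul_pinfty// lee_fin ltW.
- exists (fun=> f); split => //.
  + by rewrite z; exact: cvg_cst.
  + by rewrite z; exact: cvg_cst.
Qed.

(** The real and imaginary parts are each at most twice the L^1 norm, since |cos| and |sin| are at
    most 1; the squares add up to 8. *)
Lemma nsq_fourier1_le f xi : inL 1%:E f -> nsq (fourier1 f xi) <= 8 * normL 1%:E f ^+ 2.
Proof.
move=> f1; have [ri ii] := inL1_integrable f1; have [mf fi] := f1.
have iN : (@leb R n).-integrable setT (EFin \o (fun x => normc (f x))).
  rewrite enormL1E in fi; apply: ge0_integrable_EFin => //.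
    by move=> x; exact: normc_ge0.
  by apply/measurable_EFinP; exact: measurable_normc.
have i2 : (@leb R n).-integrable setT (EFin \o (fun x => 2 * normc (f x))).
  by apply: eq_integrable (integrableZl measurableT 2 iN).
have Fle (a b : Rn R n -> R) : (@leb R n).-integrable setT (EFin \o a) ->
    (@leb R n).-integrable setT (EFin \o b) ->
    (forall x, `|a x| <= normc (f x)) -> (forall x, `|b x| <= normc (f x)) ->
    `|fourier_re (@leb R n) (@dotp R n) a b xi| <= 2 * normL 1%:E f.
  move=> ai bi ha hb.
  have i1 := integrable_fourier_re (@measurable_dotp R n) xi ai bi.
  apply: (le_trans (le_normr_Rintegral measurableT i1)).
  rewrite /normL enormL1E -/(Rintegral _ _ _) -RintegralZl//.
  apply: le_Rintegral => //; first exact: integrable_norm.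
  move=> x _; apply: (le_trans (ler_normD _ _)); rewrite !normrM mulr2n mulrDl mul1r.
  by apply: lerD; rewrite -[leRHS]mul1r ler_pM// ?cos_max ?sin_max.
have n0 : 0 <= normL 1%:E f by rewrite fine_ge0// Lnorm_ge0.
have sq (y : R) : `|y| <= 2 * normL 1%:E f -> y ^+ 2 <= 4 * normL 1%:E f ^+ 2.
  move=> hy; rewrite -real_normK ?num_real// (_ : 4 * _ = (2 * normL 1%:E f) ^+ 2); last by ring.
  by rewrite ler_pXn2r ?nnegrE// mulr_ge0.
rewrite fourier1E /nsq/=.
have h1 : `|fourier_re (@leb R n) (@dotp R n) (fun x => complex.Re (f x))
    (fun x => complex.Im (f x)) xi| <= 2 * normL 1%:E f.
  by apply: Fle => // x; [exact: normr_Re_le|exact: normr_Im_le].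
have h2 : `|fourier_re (@leb R n) (@dotp R n) (fun x => complex.Im (f x))
    (\- (fun x => complex.Re (f x))) xi| <= 2 * normL 1%:E f.
  apply: Fle => //; first exact: integrable_opp.
    by move=> x; exact: normr_Im_le.
  by move=> x; rewrite normrN; exact: normr_Re_le.
by have := sq _ h1; have := sq _ h2; lra.
Qed.

End L2_transform.

(** * Gaussian integrals *)

Section gaussian_Rn.
Context {R : realType}.
Local Notation mu := (@lebesgue_measure R).

Lemma integral_gauss_scaled (t : R) : 0 < t ->
  (\int[mu]_x (expR (- (t * x ^+ 2)))%:E = (Num.sqrt (pi / t))%:E)%E.
Proof.
move=> t0; have st0 : 0 < Num.sqrt t by rewrite sqrtr_gt0.
have := @ge0_integral_scale R (fun x => (gauss_fun x)%:E) (Num.sqrt t) st0.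
rewrite integralT_gauss => H.
have {}H : ((Num.sqrt t)%:E * \int[mu]_x (expR (- (t * x ^+ 2)))%:E = (Num.sqrt pi)%:E)%E.
  rewrite -H; last 2 first.
  - by apply/measurable_EFinP; exact: measurable_gauss_fun.
  - by move=> x; rewrite lee_fin gauss_fun_ge0.
  congr (_ * _)%E; apply: eq_integral => x _.
  by rewrite /gauss_fun exprMn sqr_sqrtr ?ltW.
have : (((Num.sqrt t)^-1)%:E * ((Num.sqrt t)%:E * \int[mu]_x (expR (- (t * x ^+ 2)))%:E) =
    ((Num.sqrt t)^-1 * Num.sqrt pi)%:E)%E by rewrite H EFinM.
rewrite muleA -EFinM mulVf ?gt_eqF// mul1e => ->.
by rewrite sqrtrM ?pi_ge0// sqrtrV ?ltW// mulrC.
Qed.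

Lemma measurable_expR_dotp n (t : R) :
  measurable_fun setT (fun xi : Rn R n => (expR (- (t * dotp xi xi)))%:E).
Proof.
apply/measurable_EFinP; apply: (measurableT_comp (@measurable_expR R)).
apply: measurableT_comp => //; apply: measurable_funM => //.
apply: (measurableT_comp (@measurable_dotp R n) (g := fun x : Rn R n => (x, x))).
exact: measurable_fun_pair.
Qed.

Lemma integral_gauss_Rn n (t : R) : 0 < t ->
  (\int[@leb R n]_xi (expR (- (t * dotp xi xi)))%:E = (Num.sqrt (pi / t) ^+ n)%:E)%E.
Proof.
move=> t0; elim: n => [|n IH].
  rewrite integral_dirac//; last exact: measurable_expR_dotp.
  by rewrite diracT mul1e /dotp big_ord0 mulr0 oppr0 expR0 expr0.
rewrite ge0_integral_leb_succ; last 2 first.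
- exact: measurable_expR_dotp.
- by move=> xi; rewrite lee_fin expR_ge0.
pose f (p : Rn R n * measurableTypeR R) : \bar R :=
  ((expR (- (t * dotp p.1 p.1)))%:E * (expR (- (t * p.2 ^+ 2)))%:E)%E.
have m1 : measurable_fun setT (fun p : Rn R n * measurableTypeR R =>
    (expR (- (t * dotp p.1 p.1)))%:E).
  exact: (measurableT_comp (@measurable_expR_dotp n t)).
have m2' : measurable_fun setT (fun x : measurableTypeR R => (expR (- (t * x ^+ 2)))%:E).
  apply/measurable_EFinP; apply: (measurableT_comp (@measurable_expR R)).
  apply: measurableT_comp => //; apply: measurable_funM => //; exact: measurable_funX.
have m2 : measurable_fun setT (fun p : Rn R n * measurableTypeR R =>
    (expR (- (t * p.2 ^+ 2)))%:E) by exact: (measurableT_comp m2').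
transitivity (\int[(@lebfun R n \x lebesgue_measure)%E]_p f p)%E.
  apply: eq_integral => p _; rewrite /f -EFinM -expRD; congr (expR _)%:E.
  by rewrite dotp_cons /prod_phase /line_phase; ring.
rewrite fubini_tonelli1; last 2 first.
- exact: emeasurable_funM.
- by move=> p; rewrite mule_ge0// lee_fin expR_ge0.
transitivity (\int[@lebfun R n]_x ((Num.sqrt (pi / t))%:E * (expR (- (t * dotp x x)))%:E))%E.
  apply: eq_integral => x _; rewrite /fubini_F /f/= ge0_integralZl_EFin ?expR_ge0//.
  by rewrite integral_gauss_scaled// muleC.
rewrite ge0_integralZl_EFin; last 4 first.
- by [].
- by move=> x _; rewrite lee_fin expR_ge0.
- exact: measurable_expR_dotp.
- exact: sqrtr_ge0.
rewrite exprS EFinM -IH; congr (_ * _)%E; exact: eq_measure_integral.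
Qed.

End gaussian_Rn.

(** * The differential equation at a fixed frequency *)

Section ode.
Context {R : realType}.
Implicit Types (p q : R -> R) (a t : R).

(** With y = q + a p / 2 the equation becomes the system p' = y - a p / 2, y' = - a y / 2 - pi^2 p /
    4: a rotation damped at rate a / 2, along which y^2 + pi^2 p^2 / 4 decays exactly like exp (- a
    t). *)
Lemma ode_energy a p q t : 0 < t ->
  (forall s : R, 0 < s -> is_derive s (1 : R) p (q s)) ->
  (forall s : R, 0 < s -> is_derive s (1 : R) q
    (- (4^-1 * a ^+ 2 + pi ^+ 2 / 4) * p s - a * q s)) ->
  p s @[s --> 0^'+] --> p 0 -> q s @[s --> 0^'+] --> q 0 ->
  (q t + a / 2 * p t) ^+ 2 + pi ^+ 2 / 4 * p t ^+ 2 =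
  expR (- (a * t)) * ((q 0 + a / 2 * p 0) ^+ 2 + pi ^+ 2 / 4 * p 0 ^+ 2).
Proof.
move=> t0 dp dq p0 q0.
pose y : R -> R := q + (a / 2) *: p.
pose F : R -> R := (expR \o (a *: id)) * (y ^+ 2 + (pi ^+ 2 / 4) *: p ^+ 2).
have FE s : F s = expR (a * s) * ((q s + a / 2 * p s) ^+ 2 + pi ^+ 2 / 4 * p s ^+ 2) by [].
have dF (s : R) : 0 < s -> is_derive s (1 : R) F 0.
  move=> s0; have dps := dp s s0; have dqs := dq s s0.
  have dy : is_derive s (1 : R) y (q s * (a / 2) - (4^-1 * a ^+ 2 + pi ^+ 2 / 4) * p s - a * q s).
    rewrite (_ : _ - a * q s = (- (4^-1 * a ^+ 2 + pi ^+ 2 / 4) * p s - a * q s) + (a / 2) *: q s).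
      exact: (@is_deriveD _ _ _ _ _ _ _ _ _ dqs (@is_deriveZ _ _ _ _ _ _ _ _ dps)).
    by rewrite /GRing.scale/=; ring.
  have de : is_derive s (1 : R) (expR \o (a *: id)) (a * expR (a * s)).
    apply: is_derive_eq; rewrite /GRing.scale/=; ring.
  have dG := @is_deriveD _ _ _ _ _ _ _ _ _ (@is_deriveX _ _ _ 2 _ _ _ dy)
    (@is_deriveZ _ _ _ _ (pi ^+ 2 / 4) _ _ _ (@is_deriveX _ _ _ 2 _ _ _ dps)).
  have := @is_deriveM _ _ _ _ _ _ _ _ de dG; congr (is_derive _ _ _ _).
  rewrite -[LHS]/(expR (a * s) * (2 * (q s + a / 2 * p s) *
      (q s * (a / 2) - (4^-1 * a ^+ 2 + pi ^+ 2 / 4) * p s - a * q s) +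
      pi ^+ 2 / 4 * (2 * p s * q s)) +
    ((q s + a / 2 * p s) ^+ 2 + pi ^+ 2 / 4 * p s ^+ 2) * (a * expR (a * s))).
  by field.
(* The derivatives are given for s > 0 only; continuity from the right at 0 lets the mean value
   theorem reach the initial data. *)
have cF0 : F s @[s --> 0^'+] --> F 0.
  apply: cvgM; last first.
    apply: cvgD; first by apply: cvgM; apply: cvgD => //; exact: cvgZr.
    by apply: cvgZr; apply: cvgM.
  apply: cvg_at_right_filter; apply: continuous_comp; last exact: continuous_expR.
  exact: cvgZr.
have cF s : 0 < s -> {for s, continuous F}.
  by move=> s0; apply/differentiable_continuous/derivable1_diffP; case: (dF s s0).
have [| |c _] := @MVT_segment R F (cst 0) 0 t (ltW t0).
- by move=> x; rewrite in_itv/= => /andP[x0 _]; exact: dF.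
- apply/continuous_within_itvP => //; split => //.
  + by move=> x; rewrite in_itv/= => /andP[x0 _]; exact: cF.
  + by apply: cvg_at_left_filter; exact: cF.
rewrite /= mul0r => /eqP; rewrite subr_eq0 => /eqP; rewrite !FE mulr0 expR0 mul1r => <-.
by rewrite mulrA -expRD addNr expR0 mul1r.
Qed.

End ode.

Section ode_bounds.
Context {R : realType}.
Implicit Types (p q : R -> R) (a t : R).

(** A factor 4 (1 + a^2) bounds the initial energy by the data, and a factor 2 (1 + a^2) recovers a
    p and q from the energy at time t. *)
Definition ode_weight a t : R := 8 * (1 + a ^+ 2) ^+ 2 * expR (- (a * t)).

Lemma ode_weight_anti a s t : 0 <= a -> s <= t -> ode_weight a t <= ode_weight a s.
Proof.
move=> a0 st; apply: ler_wpM2l; first by rewrite mulr_ge0 ?sqr_ge0.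
by rewrite ler_expR lerN2 ler_wpM2l.
Qed.

Lemma ode_bound a p q t : 0 < t ->
  (forall s : R, 0 < s -> is_derive s (1 : R) p (q s)) ->
  (forall s : R, 0 < s -> is_derive s (1 : R) q
    (- (4^-1 * a ^+ 2 + pi ^+ 2 / 4) * p s - a * q s)) ->
  p s @[s --> 0^'+] --> p 0 -> q s @[s --> 0^'+] --> q 0 ->
  [/\ p t ^+ 2 <= ode_weight a t * (p 0 ^+ 2 + q 0 ^+ 2),
      a ^+ 2 * p t ^+ 2 <= ode_weight a t * (p 0 ^+ 2 + q 0 ^+ 2) &
      q t ^+ 2 <= ode_weight a t * (p 0 ^+ 2 + q 0 ^+ 2)].
Proof.
move=> t0 dp dq p0 q0; have := ode_energy t0 dp dq p0 q0.
rewrite /ode_weight; set E := expR _ => H.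
have E0 : 0 <= E by exact: expR_ge0.
have pi2 : 1 <= pi ^+ 2 / 4 :> R by have := pi_ge2 R; nra.
have pi4 : pi ^+ 2 / 4 <= 4 :> R by have := pihalf_lt2 R; have := pi_ge2 R; nra.
set D := p 0 ^+ 2 + q 0 ^+ 2.
have D0 : 0 <= D by rewrite addr_ge0 ?sqr_ge0.
set b := 1 + a ^+ 2; have b1 : 1 <= b by rewrite lerDl sqr_ge0.
have init : (q 0 + a / 2 * p 0) ^+ 2 + pi ^+ 2 / 4 * p 0 ^+ 2 <= 4 * b * D.
  have : (q 0 + a / 2 * p 0) ^+ 2 <= 2 * q 0 ^+ 2 + a ^+ 2 / 2 * p 0 ^+ 2.
    by have := sqr_ge0 (q 0 - a / 2 * p 0); nra.
  have : pi ^+ 2 / 4 * p 0 ^+ 2 <= 4 * p 0 ^+ 2 by rewrite ler_wpM2r ?sqr_ge0.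
  have : 0 <= a ^+ 2 * p 0 ^+ 2 by rewrite mulr_ge0 ?sqr_ge0.
  have : 0 <= a ^+ 2 * q 0 ^+ 2 by rewrite mulr_ge0 ?sqr_ge0.
  have := sqr_ge0 (q 0).
  by rewrite /b /D; nra.
set M := E * (4 * b * D).
have M0 : 0 <= M by rewrite !mulr_ge0// (le_trans ler01).
have yM : (q t + a / 2 * p t) ^+ 2 + pi ^+ 2 / 4 * p t ^+ 2 <= M.
  by rewrite H ler_wpM2l.
have pM : p t ^+ 2 <= M.
  apply: le_trans yM; have := sqr_ge0 (q t + a / 2 * p t).
  have : 1 * p t ^+ 2 <= pi ^+ 2 / 4 * p t ^+ 2 by rewrite ler_wpM2r ?sqr_ge0.
  by rewrite mul1r; lra.
have ME : 8 * b ^+ 2 * E * D = 2 * b * M by rewrite /M; ring.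
have bM : M <= b * M by rewrite ler_peMl.
have apM : a ^+ 2 * p t ^+ 2 <= a ^+ 2 * M by rewrite ler_wpM2l ?sqr_ge0.
have bME : b * M = M + a ^+ 2 * M by rewrite /b; ring.
rewrite ME; split; [lra|lra|].
have : (q t + a / 2 * p t) ^+ 2 <= M.
  by apply: le_trans yM; rewrite lerDl mulr_ge0 ?sqr_ge0// (le_trans ler01).
(* The difference of the two sides is the square of q + a p. *)
have : q t ^+ 2 <= 2 * (q t + a / 2 * p t) ^+ 2 + a ^+ 2 / 2 * p t ^+ 2.
  by have := sqr_ge0 (q t + a * p t); nra.
by lra.
Qed.

(** The mean value theorem reduces to the bound on q at an intermediate time, and the weight,
    decreasing in time, is moved back to t. This serves to bound difference quotients of the
    solution. *)
Lemma ode_increment a p q s t : 0 <= a -> 0 < t -> t < s ->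
  (forall s : R, 0 < s -> is_derive s (1 : R) p (q s)) ->
  (forall s : R, 0 < s -> is_derive s (1 : R) q
    (- (4^-1 * a ^+ 2 + pi ^+ 2 / 4) * p s - a * q s)) ->
  p s @[s --> 0^'+] --> p 0 -> q s @[s --> 0^'+] --> q 0 ->
  (p s - p t) ^+ 2 <= (s - t) ^+ 2 * (ode_weight a t * (p 0 ^+ 2 + q 0 ^+ 2)).
Proof.
move=> a0 t0 ts dp dq p0 q0.
have [| |c /[!in_itv]/= /andP[tc _] ->] := @MVT_segment R p q t s (ltW ts).
- by move=> x; rewrite in_itv/= => /andP[x0 _]; apply: dp; exact: lt_trans x0.
- have cp x : t <= x -> {for x, continuous p}.
    move=> tx; apply/differentiable_continuous/derivable1_diffP.
    by case: (dp x (lt_le_trans t0 tx)).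
  apply/continuous_within_itvP => //; split.
  + by move=> x; rewrite in_itv/= => /andP[/ltW x0 _]; exact: cp.
  + by apply: cvg_at_right_filter; exact: cp.
  + by apply: cvg_at_left_filter; apply: cp; exact: ltW.
rewrite exprMn mulrC ler_wpM2l ?sqr_ge0//.
have [_ _ /le_trans] := ode_bound (lt_le_trans t0 tc) dp dq p0 q0; apply.
by rewrite ler_wpM2r ?addr_ge0 ?sqr_ge0// ode_weight_anti.
Qed.

End ode_bounds.

Section complex_ode.
Context {R : realType}.
Implicit Types (U V phi : R -> R[i]) (a t : R).
Local Open Scope complex_scope.

Section coordinate.
Variable P : R[i] -> R.
Hypothesis PB : forall z w, P (z - w) = P z - P w.
Hypothesis PZ : forall (r : R) z, P (r%:C * z) = r * P z.
Hypothesis P_le : forall z, `|P z| <= normc z.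

Lemma is_derive_coordinate phi t l : 0 < t -> is_cderive phi t l ->
  is_derive t (1 : R) (P \o phi) (P l).
Proof.
move=> t0 dphi.
have H : h^-1 *: (((P \o phi) \o shift t) (h *: 1) - (P \o phi) t) @[h --> 0^'] --> P l.
  apply/cvgrPdist_le => eps e0.
  move/cvgrPdist_le : dphi => /(_ eps e0); rewrite /within/= => /nbhs_ballP[d /= d0 Hd].
  (* The radius is at most t to keep t + h in the half-line to which [is_cderive] is restricted. *)
  apply/nbhs_ballP; exists (Num.min d t); first by rewrite /= lt_min d0.
  move=> h /=; rewrite /ball/= sub0r normrN lt_min => /andP[hd ht] h0.
  have st : h + t != t by rewrite -subr_eq0 addrK.
  have htd : ball t d (h + t) by rewrite /ball/= opprD addrCA subrr addr0 normrN.
  have ht0 : 0 <= h + t by move: ht; rewrite ltr_norml => /andP[] ? _; lra.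
  have := Hd _ htd st ht0; rewrite sub0r normrN ger0_norm ?normc_ge0// addrK.
  apply: le_trans; apply: le_trans (P_le _); rewrite PB distrC.
  by rewrite mulrC -fmorphV PZ PB [h *: 1]mulr1.
by apply: DeriveDef; [apply/cvg_ex; exists (P l)|exact: cvg_lim H].
Qed.

Lemma cvg_coordinate phi : is_ccontinuous phi 0 ->
  P (phi s) @[s --> 0^'+] --> P (phi 0).
Proof.
move=> cphi; apply/cvgrPdist_le => eps e0.
move/cvgrPdist_le : cphi => /(_ eps e0); rewrite /within/= => /nbhs_ballP[d /= d0 Hd].
apply/nbhs_ballP; exists d => // s sd s0.
have := Hd _ sd (ltW s0); rewrite sub0r normrN ger0_norm ?normc_ge0//.
by rewrite distrC -PB; apply: le_trans.
Qed.

End coordinate.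

Lemma is_cderive_ccontinuous phi t l : is_cderive phi t l -> is_ccontinuous phi t.
Proof.
move=> dphi; apply/cvgrPdist_le => eps e0.
move/cvgrPdist_le : dphi => /(_ 1 ltr01); rewrite /within/= => /nbhs_ballP[d /= d0 Hd].
have l1 : 0 < 1 + normc l by rewrite ltr_wpDr ?normc_ge0.
(* Within distance d the difference quotient is within 1 of l, so phi is Lipschitz at t with
   constant 1 + |l|. *)
apply/nbhs_ballP; exists (Num.min d (eps / (1 + normc l))).
  by rewrite /= lt_min d0 divr_gt0.
move=> s; rewrite /ball/= lt_min => /andP[sd se] s0.
rewrite sub0r normrN ger0_norm ?normc_ge0//.
have [->|st] := eqVneq s t; first by rewrite subrr /= expr0n addr0 sqrtr0 ltW.
have := Hd s sd st s0; rewrite sub0r normrN ger0_norm ?normc_ge0//.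
set r := _ / _; move=> rl.
have st0 : (s - t)%:C != 0 by rewrite eq_complex/= eqxx andbT subr_eq0.
have -> : phi s - phi t = (s - t)%:C * ((r - l) + l) by rewrite subrK /r mulrC divfK.
rewrite ComplexField.Normc.normcM.
have -> : normc (s - t)%:C = `|t - s| by rewrite /= expr0n addr0 sqrtr_sqr distrC.
rewrite ltr_pdivlMr// in se; apply: (le_trans _ (ltW se)); rewrite ler_wpM2l//.
by apply: (le_trans (le_normcD _ _)); rewrite lerD2r.
Qed.

(** The clause of [fourier_ode] at one frequency, with a in place of [logsym xi]. *)
Definition solves_ode a U V : Prop :=
  [/\ forall t, 0 <= t -> is_cderive U t (V t),
      forall t, 0 <= t -> is_ccontinuous V t &
      forall t, 0 < t -> exists2 W : R[i], is_cderive V t W &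
        W + (4^-1 * a ^+ 2)%:C * U t + (pi ^+ 2 / 4)%:C * U t + a%:C * V t = 0].

Lemma ReZ (r : R) z : complex.Re (r%:C * z) = r * complex.Re z.
Proof. by case: z => x y /=; ring. Qed.

Lemma ImZ (r : R) z : complex.Im (r%:C * z) = r * complex.Im z.
Proof. by case: z => x y /=; ring. Qed.

Lemma solves_ode_coordinate (P : R[i] -> R) a U V :
  (forall z w, P (z - w) = P z - P w) ->
  (forall (r : R) z, P (r%:C * z) = r * P z) ->
  (forall z, `|P z| <= normc z) ->
  solves_ode a U V ->
  [/\ forall s : R, 0 < s -> is_derive s (1 : R) (P \o U) (P (V s)),
      forall s : R, 0 < s -> is_derive s (1 : R) (P \o V)
        (- (4^-1 * a ^+ 2 + pi ^+ 2 / 4) * P (U s) - a * P (V s)),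
      P (U s) @[s --> 0^'+] --> P (U 0) &
      P (V s) @[s --> 0^'+] --> P (V 0)].
Proof.
move=> PB PZ Ple [dU cV dV]; split.
- by move=> s s0; apply: is_derive_coordinate => //; apply: dU; exact: ltW.
- move=> s s0; have [W dW eW] := dV s s0.
  have -> : - (4^-1 * a ^+ 2 + pi ^+ 2 / 4) * P (U s) - a * P (V s) = P W.
    have -> : W = 0 - (4^-1 * a ^+ 2)%:C * U s - (pi ^+ 2 / 4)%:C * U s - a%:C * V s.
      by rewrite -eW; ring.
    have P0 : P 0 = 0 by rewrite -(subrr 0) PB subrr.
    by rewrite !PB !PZ P0; ring.
  exact: is_derive_coordinate.
- by apply: cvg_coordinate => //; apply: (is_cderive_ccontinuous (dU 0 _)).
- by apply: cvg_coordinate => //; exact: cV.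
Qed.

Lemma nsq_ode_bound a U V t : 0 <= a -> 0 < t -> solves_ode a U V ->
  [/\ nsq (U t) <= ode_weight a t * (nsq (U 0) + nsq (V 0)),
      a ^+ 2 * nsq (U t) <= ode_weight a t * (nsq (U 0) + nsq (V 0)) &
      forall s, t < s -> nsq (U s - U t) <=
        (s - t) ^+ 2 * (ode_weight a t * (nsq (U 0) + nsq (V 0)))].
Proof.
move=> a0 t0 ode.
have [dp dq p0 q0] := solves_ode_coordinate (@ReB R) ReZ (@normr_Re_le R) ode.
have [dp' dq' p0' q0'] := solves_ode_coordinate (@ImB R) ImZ (@normr_Im_le R) ode.
have [b1 b2 _] := ode_bound t0 dp dq p0 q0; have [b1' b2' _] := ode_bound t0 dp' dq' p0' q0'.
have E : ode_weight a t * (nsq (U 0) + nsq (V 0)) =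
    ode_weight a t * (complex.Re (U 0) ^+ 2 + complex.Re (V 0) ^+ 2) +
    ode_weight a t * (complex.Im (U 0) ^+ 2 + complex.Im (V 0) ^+ 2).
  by rewrite /nsq; ring.
rewrite E; split.
- exact: lerD.
- by rewrite /nsq mulrDr; exact: lerD.
- move=> s ts; rewrite /nsq ReB ImB mulrDr; apply: lerD.
  + exact: (ode_increment a0 t0 ts dp dq p0 q0).
  + exact: (ode_increment a0 t0 ts dp' dq' p0' q0').
Qed.

End complex_ode.

(** * The symbol log (1 + x) and its exponential weight *)

Section symbol.
Context {R : realType}.
Implicit Types x t : R.

(** This is exp y >= 1 + y at y = - x / (1 + x), inverted. *)
Lemma ge0_ln1D_ge x : 0 <= x -> x / (1 + x) <= ln (1 + x).
Proof.
move=> x0; have x1 : 0 < 1 + x by rewrite ltr_pwDl.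
rewrite -ler_expR lnK ?posrE// -[leRHS]invrK -[leLHS]invrK.
rewrite lef_pV2 ?posrE ?invr_gt0 ?expR_gt0// -expRN; apply: le_trans (expR_ge1Dx _).
by rewrite (_ : 1 - x / (1 + x) = (1 + x)^-1)//; field; rewrite gt_eqF.
Qed.

(* Low frequencies, [x <= 7], give the Gaussian and high ones the exponential. *)
Lemma ode_weight_logsym x t : 0 <= x -> 1 <= t ->
  ode_weight (ln (1 + x)) t <= 8 * 12 ^+ 4 * (expR (- (t / 8 * x)) + expR (- (8 / 9) * t)).
Proof.
move=> x0 t1; set a := ln (1 + x).
have x1 : 0 < 1 + x by rewrite ltr_pwDl.
have a0 : 0 <= a by rewrite ln_ge0// lerDl.
have [x7|x7] := leP x 7.
(* Here 1 + x <= 8, which gives the rate 1 / 8 in the Gaussian. *)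
- have ax : x / 8 <= a.
    apply: le_trans (ge0_ln1D_ge x0).
    by rewrite ler_wpM2l// lef_pV2 ?posrE//; lra.
  have a7 : a <= 7.
    have : a <= x by rewrite /a; apply: le_ln1Dx; lra.
    by lra.
  have e1 : expR (- (a * t)) <= expR (- (t / 8 * x)).
    by rewrite ler_expR lerN2; nra.
  have e2 := expR_ge0 (- (8 / 9) * t); have e3 := expR_ge0 (- (a * t)).
  have b : (1 + a ^+ 2) ^+ 2 <= 50 ^+ 2 by rewrite ler_pXn2r ?nnegrE ?addr_ge0 ?sqr_ge0//; nra.
  have : (1 + a ^+ 2) ^+ 2 * expR (- (a * t)) <= 50 ^+ 2 * expR (- (a * t)) by rewrite ler_wpM2r.
  by rewrite /ode_weight; lra.
(* From exp (- 1 / 3) >= 2 / 3 one gets exp (4 / 3) <= (3 / 2)^4 = 81 / 16, which is below 8 < 1 +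
   x. *)
- have a43 : 4 / 3 <= a.
    rewrite /a -ler_expR lnK ?posrE//.
    have h : expR 3^-1 <= 3 / 2 :> R.
      rewrite -[leRHS]invrK -[leLHS]invrK lef_pV2 ?posrE ?invr_gt0 ?expR_gt0//.
      by rewrite -expRN; apply: le_trans (expR_ge1Dx _); lra.
    rewrite expRM_natl; apply: (@le_trans _ _ ((3 / 2) ^+ 4)); last by lra.
    by rewrite ler_pXn2r ?nnegrE ?expR_ge0//; lra.
  (* The polynomial is at most (1 + a)^4, and 1 + a <= 12 exp (a / 12). The loss exp (a / 3) leaves
     the exponent - 2 a t / 3 because t >= 1. *)
  have b : (1 + a ^+ 2) ^+ 2 <= 12 ^+ 4 * expR (a / 3).
    apply: (@le_trans _ _ ((1 + a) ^+ 4)).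
      rewrite (_ : (1 + a) ^+ 4 = ((1 + a) ^+ 2) ^+ 2); last by rewrite -exprM.
      by rewrite ler_pXn2r ?nnegrE ?addr_ge0 ?sqr_ge0//; nra.
    rewrite (_ : a / 3 = 4 * (a / 12)); last by field.
    rewrite expRM_natl -exprMn ler_pXn2r ?nnegrE ?mulr_ge0 ?expR_ge0 ?addr_ge0//.
    by have := expR_ge1Dx (a / 12); lra.
  have e : expR (a / 3) * expR (- (a * t)) <= expR (- (8 / 9) * t).
    by rewrite -expRD ler_expR; nra.
  have : (1 + a ^+ 2) ^+ 2 * expR (- (a * t)) <= 12 ^+ 4 * (expR (a / 3) * expR (- (a * t))).
    by rewrite mulrA ler_wpM2r ?expR_ge0.
  by rewrite /ode_weight; have := expR_ge0 (- (t / 8 * x)); lra.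
Qed.

Lemma sqrt_gauss_scale n t : 0 < t ->
  Num.sqrt (pi / (t / 8)) ^+ n = Num.sqrt (8 * pi) ^+ n * t `^ (- (n%:R / 2)).
Proof.
move=> t0; rewrite (_ : pi / (t / 8) = 8 * pi * t^-1); last by field; rewrite gt_eqF.
rewrite sqrtrM ?mulr_ge0 ?pi_ge0// exprMn; congr (_ * _).
rewrite -powR12_sqrt; last by rewrite invr_ge0 ltW.
rewrite -powR_mulrn ?powR_ge0// -powRrM.
rewrite -powR_inv1; last exact: ltW.
by rewrite -powRrM; congr (_ `^ _); field.
Qed.

End symbol.

(** * Decay of the energy *)

Section energy_decay.
Context {R : realType} {n : nat}.
Implicit Types (f g : Rn R n -> R[i]) (t : R) (xi : Rn R n).
Local Open Scope complex_scope.

Lemma E2_ae_le f (B : Rn R n -> R) : cmeasurable f -> measurable_fun setT B ->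
  (forall xi, 0 <= B xi) -> {ae leb n, forall xi, nsq (f xi) <= B xi} ->
  (E2 f <= \int[leb n]_xi (B xi)%:E)%E.
Proof.
move=> mf mB B0 fB; apply: ge0_ae_le_integral.
- exact: measurable_nsq.
- exact/measurable_EFinP.
- by move=> x; rewrite lee_fin nsq_ge0.
- by move=> x; rewrite lee_fin.
- by apply: ae_imply fB => x; rewrite lee_fin.
Qed.

(* When the set of representatives of Lf is empty, [opL f] is zero. *)
Lemma E2_opL_le K f g (B : Rn R n -> R) : 0 < K ->
  (forall h k : Rn R n -> R[i], is_fourier h k -> (E2 h <= K%:E * E2 k)%E) ->
  is_fourier f g -> measurable_fun setT B -> (forall xi, 0 <= B xi) ->
  {ae leb n, forall xi, logsym xi ^+ 2 * nsq (g xi) <= B xi} ->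
  (E2 (opL f) <= K%:E * \int[leb n]_xi (B xi)%:E)%E.
Proof.
move=> K0 HK fg mB B0 gB; rewrite /opL; case: xgetP => [h _ [g' fg' hg']|_].
  apply: (le_trans (HK _ _ hg')); rewrite lee_pmul2l//.
  have [_ [mg' _] _] := hg'; apply: E2_ae_le => //.
  (* The chosen representative comes with its own transform g' of f, equal to g only almost
     everywhere. *)
  apply: filterS2 gB (is_fourier_unique fg fg') => xi gB <-.
  by rewrite nsqM nsqC.
rewrite (_ : E2 _ = 0%E); last first.
  by apply: integral0_eq => x _; rewrite /nsq/= expr0n addr0.
by rewrite mule_ge0 ?lee_fin ?(ltW K0)// integral_ge0// => x _; rewrite lee_fin.
Qed.

Lemma E2_div f (r : R) : cmeasurable f -> r != 0 ->
  cmeasurable (fun x => f x / r%:C) /\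
  E2 (fun x => f x / r%:C) = ((r ^- 2)%:E * E2 f)%E.
Proof.
move=> mf r0; have E x : f x / r%:C = (r^-1)%:C * f x by rewrite mulrC fmorphV.
split.
- have [mr mi] := mf; split; under eq_fun do rewrite E ?ReZ ?ImZ; exact: measurable_funM.
- rewrite /E2 -ge0_integralZl_EFin//; last 3 first.
  + by move=> x _; rewrite lee_fin nsq_ge0.
  + exact: measurable_nsq.
  + by rewrite invr_ge0 sqr_ge0.
  by apply: eq_integral => x _; rewrite E nsqM nsqC exprVn.
Qed.

(* The time derivative is bounded through its difference quotients, whose
   transforms are controlled pointwise. *)
Lemma E2_time_derivative_le K (u ut U : R -> Rn R n -> R[i]) t (b : R) :
  0 < K -> (forall h k : Rn R n -> R[i], is_fourier h k -> (E2 h <= K%:E * E2 k)%E) ->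
  (forall s, 0 <= s -> is_fourier (u s) (U s)) -> C1_L2 u ut -> 0 < t ->
  (forall s, t < s -> (E2 (fun xi => U s xi - U t xi)%R <= ((s - t) ^+ 2 * b)%:E)%E) ->
  (E2 (ut t) <= (2 * K * b)%:E)%E.
Proof.
move=> K0 HK uU C1 t0 Ub; have [utL [mut _] du _] := C1 t (ltW t0).
apply/lee_addgt0Pr => eps e0; have e2 : 0 < eps / 2 by rewrite divr_gt0.
have FF : Filter (within [set s : R | 0 <= s] t^') by exact: within_filter.
have := cvg_enormL2_near FF du e2.
rewrite /within/= => /nbhs_ballP[d /= d0 Hd].
(* A single later time is enough: the difference quotient at s is close to [ut t], and its squared
   norm is at most K b. *)
set s := t + d / 2.
have st : s - t = d / 2 by rewrite /s addrAC subrr add0r.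
have ts : t < s by rewrite -subr_gt0 st divr_gt0.
have st0 : s - t != 0 by rewrite gt_eqF// subr_gt0.
have s0 : 0 < s by exact: lt_trans ts.
have Hs : (E2 (fun x => (u s x - u t x) / (s - t)%:C - ut t x)%R <= (eps / 2)%:E)%E.
  apply: Hd.
  - by rewrite /ball/= distrC st ger0_norm; lra.
  - by rewrite gt_eqF.
  - exact: ltW.
have Fst := is_fourierB (uU s (ltW s0)) (uU t (ltW t0)).
have [[mst _] _ _] := Fst.
have [mq Eq] := E2_div mst st0.
rewrite E2BC in Hs; apply: (le_trans (E2_le_sub mut mq)); rewrite addeC.
apply: (@le_trans _ _ (2%:E * (K * b)%:E + 2%:E * (eps / 2)%:E)%E); last first.
  by rewrite -!EFinM -EFinD lee_fin; lra.
apply: leeD; rewrite lee_pmul2l//.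
rewrite Eq; apply: (@le_trans _ _ (((s - t) ^- 2)%:E * (K%:E * ((s - t) ^+ 2 * b)%:E))%E).
  rewrite lee_pmul2l//; last by rewrite lte_fin invr_gt0 exprn_gt0// subr_gt0.
  by apply: (le_trans (HK _ _ Fst)); rewrite lee_pmul2l//; exact: Ub.
rewrite -!EFinM lee_fin le_eqVlt; apply/orP; left; apply/eqP; field.
exact: st0.
Qed.

(** In the Gaussian term the data are replaced by the uniform bound D of their transforms; in the
    exponential term they are kept, to be integrated in L^2. *)
Definition envelope f g (D t : R) xi : R :=
  8 * 12 ^+ 4 * (D * expR (- (t / 8 * dotp xi xi)) +
    expR (- (8 / 9) * t) * (nsq (f xi) + nsq (g xi))).

Lemma envelope_ge0 f g D t xi : 0 <= D -> 0 <= envelope f g D t xi.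
Proof.
move=> D0; rewrite /envelope mulr_ge0// addr_ge0//.
  by rewrite mulr_ge0 ?expR_ge0.
by rewrite mulr_ge0 ?expR_ge0// addr_ge0 ?nsq_ge0.
Qed.

Lemma measurable_envelope f g D t : cmeasurable f -> cmeasurable g ->
  measurable_fun setT (envelope f g D t).
Proof.
move=> mf mg; apply: measurable_funM => //; apply: measurable_funD.
  apply: measurable_funM => //; apply/measurable_EFinP; exact: measurable_expR_dotp.
apply: measurable_funM => //; apply: measurable_funD; apply/measurable_EFinP; exact: measurable_nsq.
Qed.

Lemma integral_envelope f g D t : cmeasurable f -> cmeasurable g -> 0 <= D -> 0 < t ->
  (\int[leb n]_xi (envelope f g D t xi)%:E =
   (8 * 12 ^+ 4)%:E * ((D * (Num.sqrt (8 * pi) ^+ n * t `^ (- (n%:R / 2))))%:E +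
     (expR (- (8 / 9) * t))%:E * (E2 f + E2 g)))%E.
Proof.
move=> mf mg D0 t0.
have m1 : measurable_fun setT (fun xi : Rn R n => (expR (- (t / 8 * dotp xi xi)))%:E).
  exact: measurable_expR_dotp.
have [mnf mng] := (measurable_nsq mf, measurable_nsq mg).
have m2 : measurable_fun setT (fun xi => (nsq (f xi))%:E + (nsq (g xi))%:E)%E.
  exact: emeasurable_funD.
have p2 xi : (0 <= (nsq (f xi))%:E + (nsq (g xi))%:E)%E by rewrite adde_ge0// lee_fin nsq_ge0.
transitivity (\int[leb n]_xi ((8 * 12 ^+ 4)%:E * (D%:E * (expR (- (t / 8 * dotp xi xi)))%:E +
    (expR (- (8 / 9) * t))%:E * ((nsq (f xi))%:E + (nsq (g xi))%:E))))%E.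
  by apply: eq_integral => xi _; rewrite -!(EFinM, EFinD).
rewrite ge0_integralZl_EFin//; last 2 first.
- move=> xi _; apply: adde_ge0; first by rewrite -EFinM lee_fin mulr_ge0 ?expR_ge0.
  by rewrite mule_ge0// lee_fin expR_ge0.
- by apply: emeasurable_funD; exact: measurable_funeM.
congr (_ * _)%E; rewrite ge0_integralD//; last 4 first.
- by move=> xi _; rewrite -EFinM lee_fin mulr_ge0 ?expR_ge0.
- exact: measurable_funeM.
- by move=> xi _; rewrite mule_ge0// lee_fin expR_ge0.
- exact: measurable_funeM.
congr (_ + _)%E.
  rewrite ge0_integralZl_EFin//.
  by rewrite integral_gauss_Rn ?divr_gt0// sqrt_gauss_scale.
rewrite ge0_integralZl_EFin ?expR_ge0//; congr (_ * _)%E.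
by rewrite ge0_integralD// => xi _; rewrite lee_fin nsq_ge0.
Qed.

End energy_decay.

Section solution_decay.
Context {R : realType} {n : nat}.
Local Open Scope complex_scope.

Lemma dotpp_ge0 (xi : Rn R n) : 0 <= dotp xi xi.
Proof. by apply: sumr_ge0 => i _; rewrite -expr2 sqr_ge0. Qed.

Lemma solution_energy_le : exists2 C : R, 0 < C &
  forall (u0 u1 : Rn R n -> R[i]) (u ut : R -> Rn R n -> R[i]) (t : R),
    inL 2%:E u0 -> inL 1%:E u0 -> inL 2%:E u1 -> inL 1%:E u1 ->
    is_solution u0 u1 u ut -> 1 <= t ->
    normL 2%:E (ut t) ^+ 2 + 4^-1 * normL 2%:E (opL (u t)) ^+ 2
      + pi ^+ 2 / 4 * normL 2%:E (u t) ^+ 2 <=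
    C * ((normL 1%:E u0 ^+ 2 + normL 1%:E u1 ^+ 2) * t `^ (- (n%:R / 2)) +
         expR (- (8 / 9) * t) * (normL 2%:E u0 ^+ 2 + normL 2%:E u1 ^+ 2)).
Proof.
have [K K0 HK] := @is_fourier_le R n.
pose c : R := 8 * 12 ^+ 4; have c0 : 0 < c by rewrite mulr_gt0// exprn_gt0.
pose G : R := Num.sqrt (8 * pi) ^+ n; have G0 : 0 <= G by rewrite exprn_ge0// sqrtr_ge0.
(* The three norms contribute 2, 1 / 4 and pi^2 / 4 <= 4, at most 7 in all. K carries the bounds
   back to the solution, 8 is that of [nsq_fourier1_le], G comes from the Gaussian integral, and the
   inner K from the L^2 norms of the data. *)
exists (7 * K * c * (8 * G + K)).
  by rewrite mulr_gt0 ?ltr_wpDl ?mulr_ge0// mulr_gt0// mulr_gt0.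
move=> u0 u1 u ut t u02 u01 u12 u11 [_ C1 _ _ [U [V [uU u0U u1V ode]]]] t1.
have t0 : 0 < t by exact: lt_le_trans t1.
pose D := 8 * (normL 1%:E u0 ^+ 2 + normL 1%:E u1 ^+ 2).
have D0 : 0 <= D by rewrite mulr_ge0// addr_ge0 ?sqr_ge0.
pose B := envelope (U 0) (V 0) D t.
have [[_ [mU0 _] _] [_ [mV0 _] _]] := (u0U, u1V).
have mB : measurable_fun setT B by exact: measurable_envelope.
have B0 xi : 0 <= B xi by exact: envelope_ge0.
have pointwise : {ae @leb R n, forall xi,
    [/\ nsq (U t xi) <= B xi, logsym xi ^+ 2 * nsq (U t xi) <= B xi &
        forall s, t < s -> nsq (U s xi - U t xi) <= (s - t) ^+ 2 * B xi]}.
  (* U 0 and V 0 are only some representatives; the L^1 bound concerns the integral transforms, with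
     which they agree almost everywhere. *)
  have U0E := is_fourier_unique u0U (is_fourier_fourier1 u01 u02).
  have V0E := is_fourier_unique u1V (is_fourier_fourier1 u11 u12).
  apply: filterS3 U0E V0E ode => xi U0E V0E ode.
  have l0 : 0 <= logsym xi by rewrite ln_ge0// lerDl dotpp_ge0.
  have S0 : 0 <= nsq (U 0 xi) + nsq (V 0 xi) by rewrite addr_ge0 ?nsq_ge0.
  have SD : nsq (U 0 xi) + nsq (V 0 xi) <= D.
    by rewrite U0E V0E /D mulrDr lerD// nsq_fourier1_le.
  have W : ode_weight (logsym xi) t * (nsq (U 0 xi) + nsq (V 0 xi)) <= B xi.
    apply: le_trans (ler_wpM2r S0 (ode_weight_logsym (dotpp_ge0 xi) t1)) _.
    rewrite /B /envelope -[leLHS]mulrA (ler_pM2l c0) mulrDl lerD2r [leLHS]mulrC.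
    by rewrite ler_wpM2r ?expR_ge0.
  have [b1 b2 b3] := nsq_ode_bound l0 t0 ode.
  split; [exact: le_trans W|exact: le_trans W|move=> s /b3/le_trans; apply].
  by rewrite ler_wpM2l ?sqr_ge0.
have fin (f g : Rn R n -> R[i]) : is_fourier f g -> exists2 e : R,
    E2 g = e%:E & e <= K * normL 2%:E f ^+ 2.
  move=> fg; have [/inL2P[_ f2] _ _] := fg; have [+ _] := HK _ _ fg.
  rewrite (normL2_sqrE f2) -EFinM; have := E2_ge0 g; case: (E2 g) => // e _.
  by rewrite lee_fin => ?; exists e.
have [e0 E0 e0le] := fin _ _ u0U; have [e1 E1 e1le] := fin _ _ u1V.
pose T := t `^ (- (n%:R / 2)); pose X := expR (- (8 / 9) * t).
pose b := c * (D * (G * T) + X * (e0 + e1)).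
have Bb : (\int[@leb R n]_xi (B xi)%:E = b%:E)%E.
  by rewrite integral_envelope// E0 E1 -!(EFinM, EFinD).
have Kle (h k : Rn R n -> R[i]) : is_fourier h k -> (E2 h <= K%:E * E2 k)%E by move=> /HK[].
have uUt := uU t (ltW t0); have [_ [mUt _] _] := uUt.
have ub : normL 2%:E (u t) ^+ 2 <= K * b.
  rewrite -lee_fin; apply: (le_trans (normL2_sqr_le _)).
  apply: (le_trans (Kle _ _ uUt)); rewrite EFinM lee_pmul2l// -Bb.
  by apply: E2_ae_le => //; apply: ae_imply pointwise => xi [].
have Lb : normL 2%:E (opL (u t)) ^+ 2 <= K * b.
  rewrite -lee_fin; apply: (le_trans (normL2_sqr_le _)); rewrite EFinM -Bb.
  by apply: (E2_opL_le K0 Kle uUt) => //; apply: ae_imply pointwise => xi [].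
have utb : normL 2%:E (ut t) ^+ 2 <= 2 * K * b.
  rewrite -lee_fin; apply: (le_trans (normL2_sqr_le _)).
  apply: (E2_time_derivative_le K0 Kle uU C1 t0) => s ts.
  rewrite EFinM -Bb -ge0_integralZl_EFin ?sqr_ge0//; last 2 first.
  - by move=> xi _; rewrite lee_fin.
  - exact/measurable_EFinP.
  have -> : (\int[@leb R n]_xi (((s - t) ^+ 2)%:E * (B xi)%:E) =
      \int[@leb R n]_xi ((s - t) ^+ 2 * B xi)%:E)%E.
    by apply: eq_integral => xi _; rewrite EFinM.
  have [_ [mUs _] _] := uU s (ltW (lt_trans t0 ts)).
  apply: E2_ae_le.
  - exact: cmeasurableB.
  - exact: measurable_funM.
  - by move=> xi; rewrite mulr_ge0 ?sqr_ge0.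
  - by apply: ae_imply pointwise => xi [_ _]; apply.
have T0 : 0 <= T by exact: powR_ge0.
have X0 : 0 <= X by exact: expR_ge0.
set m := normL 1%:E u0 ^+ 2 + normL 1%:E u1 ^+ 2; set w := normL 2%:E u0 ^+ 2 + normL 2%:E u1 ^+ 2.
have m0 : 0 <= m by rewrite addr_ge0 ?sqr_ge0.
have w0 : 0 <= w by rewrite addr_ge0 ?sqr_ge0.
have bc : b <= c * ((8 * G + K) * (m * T + X * w)).
  rewrite ler_pM2l//; have : X * (e0 + e1) <= X * (K * w).
    by rewrite ler_wpM2l// /w mulrDr lerD.
  have : 0 <= K * (m * T) by rewrite !mulr_ge0// ltW.
  have : 0 <= G * (X * w) by rewrite !mulr_ge0.
  by rewrite /D -/m; nra.
have pi4 : pi ^+ 2 / 4 <= 4 :> R by have := pihalf_lt2 R; have := pi_ge2 R; nra.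
have b0 : 0 <= b by rewrite -lee_fin -Bb integral_ge0// => xi _; rewrite lee_fin.
have Kb0 : 0 <= K * b by rewrite mulr_ge0// ltW.
have h1 : pi ^+ 2 / 4 * normL 2%:E (u t) ^+ 2 <= 4 * (K * b).
  by apply: ler_pM => //; rewrite ?sqr_ge0// divr_ge0// sqr_ge0.
have h2 : K * b <= K * (c * ((8 * G + K) * (m * T + X * w))) by rewrite ler_pM2l.
rewrite -/T -/X (_ : 7 * K * c * _ * _ = 7 * (K * (c * ((8 * G + K) * (m * T + X * w))))).
  by lra.
by ring.
Qed.

End solution_decay.

Theorem theorem2p7 (R : realType) (N : nat) (hN : (3 <= N)%N) :
  exists C t0 : R, [/\ 0 < C, 0 < t0 &
    forall (u0 u1 : Rn R N -> R[i]) (u ut : R -> Rn R N -> R[i]),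
      domL u0 -> inL 1%:E u0 ->
      inL 2%:E u1 -> inL 1%:E u1 ->
      is_solution u0 u1 u ut ->
      forall t : R, t0 <= t ->
        normL 2%:E (ut t) ^+ 2
          + 4^-1 * normL 2%:E (opL (u t)) ^+ 2
          + pi ^+ 2 / 4 * normL 2%:E (u t) ^+ 2
        <= C * (normL 1%:E u1 ^+ 2 * t `^ (- (N%:R / 2))
                + normL 1%:E u0 ^+ 2 * t `^ (- ((N%:R + 4) / 2))
                + pi ^+ 2 * normL 1%:E u0 ^+ 2 * t `^ (- (N%:R / 2)))
           + C * (2 `^ (- (2 / 3) * t) * normL 2%:E u1 ^+ 2
                  + (16 + 9 * pi ^+ 2) / 36 * 2 `^ (- (2 / 3) * t)
                    * normL 2%:E u0 ^+ 2)
           + C * expR (- (8 / 9) * t) * energy0 u0 u1].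
Proof.
have [C C0 HC] := @solution_energy_le R N.
(* The factor 2 compensates the 1 / 2 in [energy0], and t >= 1 is where the weight is controlled. *)
exists (2 * C), 1; split => //; first by rewrite mulr_gt0.
move=> u0 u1 u ut [u02 _] u01 u12 u11 sol t t1.
apply: (le_trans (HC _ _ _ _ _ u02 u01 u12 u11 sol t1)).
set T := t `^ _; set T' := t `^ _; set X := expR _; set Y := 2 `^ _.
have [T0 T'0 Y0] : [/\ 0 <= T, 0 <= T' & 0 <= Y] by split; exact: powR_ge0.
have X0 : 0 <= X by exact: expR_ge0.
have pi1 : 4 <= pi ^+ 2 :> R by have := pi_ge2 R; nra.
have energy : normL 2%:E u0 ^+ 2 + normL 2%:E u1 ^+ 2 <= 2 * energy0 u0 u1.
  have := sqr_ge0 (normL 2%:E (opL u0)).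
  have : 1 * normL 2%:E u0 ^+ 2 <= pi ^+ 2 / 4 * normL 2%:E u0 ^+ 2.
    by apply: ler_wpM2r; [exact: sqr_ge0|lra].
  by rewrite /energy0; lra.
set m0 := normL 1%:E u0 ^+ 2; set m1 := normL 1%:E u1 ^+ 2.
have m00 : 0 <= m0 by exact: sqr_ge0.
have m10 : 0 <= m1 by exact: sqr_ge0.
(* The term with pi^2 alone covers m0 T, since pi^2 >= 1. *)
have low : (m0 + m1) * T <= m1 * T + m0 * T' + pi ^+ 2 * m0 * T.
  have : 0 <= m0 * T' by rewrite mulr_ge0.
  have : 1 * (m0 * T) <= pi ^+ 2 * (m0 * T).
    by apply: ler_wpM2r; [exact: mulr_ge0|lra].
  by lra.
have high : X * (normL 2%:E u0 ^+ 2 + normL 2%:E u1 ^+ 2) <= 2 * (X * energy0 u0 u1).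
  by rewrite [leRHS]mulrCA ler_wpM2l.
set Q := _ + pi ^+ 2 * m0 * T in low *.
set Z := Y * _ + _; have Z0 : 0 <= Z.
  apply: addr_ge0; apply: mulr_ge0; rewrite ?sqr_ge0//.
  by apply: mulr_ge0 => //; lra.
have L0 : 0 <= (m0 + m1) * T by rewrite mulr_ge0// addr_ge0.
rewrite (_ : 2 * C * Q + _ + _ = C * (2 * (Q + Z + X * energy0 u0 u1))); last by ring.
by rewrite ler_pM2l//; lra.
Qed.
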